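(* Let $X_V=(X_V(t))_{t\in\mathbb Z}$ be a stationary stochastic process and let $G=(V,E)$ be a mixed graph. Suppose that for all subsets $A,B,C$ of $V$, all $k\in\mathbb N$ and all $t\in\mathbb Z$, the $\sigma$-algebras $\mathscr X_A(t)$ and $\mathscr X_B(t)$ are measurably separable conditionally on $\mathscr X_{A\cap B}(t)\vee\mathscr X_C(t-k)$, and that one of the following conditions holds: (i) $X_V$ is a Gaussian process; (ii) $X_v(t+1)$, $v\in V$, are mutually contemporaneously independent, that is, the joint conditional distribution factorizes as $$\mathbb P^{X_V(t+1)\mid \mathbf X_V(t)}=\bigotimes_{v\in V}\mathbb P^{X_v(t+1)\mid\mathbf X_V(t)}\quad\text{for all }t\in\mathbb Z;$$ (iii) $X_V(t+1)$ depends on its past only in its conditional mean, that is, $$X_V(t+1)-\mathbb E\big[X_V(t+1)\mid\mathscr X_V(t)\big]\ \perp\!\!\!\perp\ \mathscr X_V(t)\quad\text{for all }t\in\mathbb Z.$$ Then the three Granger-causal Markov properties (BC), (LC) and (PC) of $X_V$ with respect to $G$ are equivalent.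
   Context: Setting. $V$ is a finite set and $X_V=(X_V(t))_{t\in\mathbb Z}$, $X_V(t)=(X_v(t))_{v\in V}\in\mathbb R^V$, is a stationary stochastic process on a probability space $(\Omega,\mathscr F,\mathbb P)$. For $A\subseteq V$, $X_A$ is the subprocess with components $X_a$, $a\in A$; $\mathbf X_A(t)=(X_A(s))_{s\le t}$; $\mathscr X_A(t)$ is the $\sigma$-algebra generated by $\mathbf X_A(t)$; $\mathscr X_A=(\mathscr X_A(t))_{t\in\mathbb Z}$. $\mathbb P^{Y\mid Z}$ denotes the conditional distribution of $Y$ given $Z$. Singletons are written without braces. $\mathbb N=\{1,2,\dots\}$. $\mathscr F_1\vee\mathscr F_2$ is the smallest $\sigma$-algebra containing $\mathscr F_1\cup\mathscr F_2$. $\mathscr F_1\perp\!\!\!\perp\mathscr F_2\mid\mathscr F_3$ means conditional independence of $\mathscr F_1$ and $\mathscr F_2$ given $\mathscr F_3$; without conditioning it means independence. Measurable separability. $\overline{\mathscr H}$ is the $\sigma$-algebra generated by $\mathscr H$ and the $\mathbb P$-null sets of $\mathscr F$. $\mathscr F_2$ and $\mathscr F_3$ are measurably separable conditionally on $\mathscr F_4$ if $\overline{\mathscr F_2\vee\mathscr F_4}\cap\overline{\mathscr F_3\vee\mathscr F_4}=\overline{\mathscr F_4}$. Granger noncausality. For disjoint $A,B\subseteq V$: - $X_A\nrightarrow X_B\,[\mathscr X_V]$ if $\mathscr X_B(t+1)\perp\!\!\!\perp\mathscr X_A(t)\mid\mathscr X_{V\setminus A}(t)$ for all $t\in\mathbb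 Z$; - $X_A\nsim X_B\,[\mathscr X_V]$ if $\mathscr X_A(t+1)\perp\!\!\!\perp\mathscr X_B(t+1)\mid\mathscr X_V(t)\vee\mathscr X_{V\setminus(A\cup B)}(t+1)$ for all $t\in\mathbb Z$. Graphs. A mixed graph $G=(V,E)$ has directed edges $a\to b$ and undirected edges $a - b$ between distinct vertices (several edges of different type or direction between the same two vertices are allowed; no self-loops). $\mathrm{pa}(a)=\{v: v\to a\in E\}$, $\mathrm{ne}(a)=\{v: v - a\in E\}$, $\mathrm{pa}(A)=\bigcup_{a\in A}\mathrm{pa}(a)\setminus A$, $\mathrm{ne}(A)=\bigcup_{a\in A}\mathrm{ne}(a)\setminus A$. Markov properties of $X_V$ with respect to $G$: - (PC), pairwise: for all $a\ne b$ in $V$: (i) $a\to b\notin E\Rightarrow X_a\nrightarrow X_b\,[\mathscr X_V]$; (ii) $a - b\notin E\Rightarrow X_a\nsim X_b\,[\mathscr X_V]$. - (LC), local: for all $a\in V$: (i) $X_{V\setminus(\mathrm{pa}(a)\cup\{a\})}\nrightarrow X_a\,[\mathscr X_V]$; (ii) $X_{V\setminus(\mathrm{ne}(a)\cup\{a\})}\nsim X_a\,[\mathscr X_V]$. - (BC), block-recursive: for all $A\subseteq V$: (i) $X_{V\setminus(\mathrm{pa}(A)\cup A)}\nrightarrow X_A\,[\mathscr X_V]$; (ii) $X_{V\setminus(\mathrm{ne}(A)\cup A)}\nsim X_A\,[\mathscr X_V]$. *)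

(* Defs.v *)
From HB Require Import structures.
From mathcomp Require Import all_boot all_order all_algebra.
From mathcomp Require Import all_classical all_reals all_analysis.

Set Implicit Arguments.
Unset Strict Implicit.
Unset Printing Implicit Defensive.

Import Order.TTheory GRing.Theory Num.Theory.
Import numFieldNormedType.Exports.

Local Open Scope classical_set_scope.
Local Open Scope ring_scope.

Record mixed_graph (V : finType) := MixedGraph {
  dedge : rel V; (* [dedge a b]: the edge a --> b is present *)
  uedge : rel V; (* [uedge a b]: the edge a --- b is present *)
  dedge_irr : irreflexive dedge;
  uedge_irr : irreflexive uedge;
  uedge_sym : symmetric uedge }.

Definition pa1 (V : finType) (G : mixed_graph V) (a : V) : {set V} :=
  [set v | dedge G v a]%SET.

Definition ne1 (V : finType) (G : mixed_graph V) (a : V) : {set V} :=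
  [set v | uedge G v a]%SET.

Definition pa (V : finType) (G : mixed_graph V) (A : {set V}) : {set V} :=
  (\bigcup_(a in A) pa1 G a :\: A)%SET.

Definition ne (V : finType) (G : mixed_graph V) (A : {set V}) : {set V} :=
  (\bigcup_(a in A) ne1 G a :\: A)%SET.

(* Sub-sigma-algebras of a measurableType are plain families of sets. *)

Definition join_sigma (T : Type) (F1 F2 : set (set T)) : set (set T) :=
  <<s F1 `|` F2 >>.

Definition sigma_family (T : pointedType) (R : realType) (J : Type)
    (D : set J) (f : J -> T -> R) : set (set T) :=
  <<s \bigcup_(j in D) g_sigma_algebra_preimage (f j) >>.

Definition sigma_completion d (T : measurableType d) (R : realType)
    (P : probability T R) (H : set (set T)) : set (set T) :=
  <<s H `|` [set N | measurable N /\ P N = 0%E] >>.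

Definition measurably_separable d (T : measurableType d) (R : realType)
    (P : probability T R) (F2 F3 F4 : set (set T)) : Prop :=
  sigma_completion P (join_sigma F2 F4) `&` sigma_completion P (join_sigma F3 F4)
  = sigma_completion P F4.

(* [g] is a version of the conditional expectation E[f | G]. *)
Definition is_cond_exp d (T : measurableType d) (R : realType)
    (P : probability T R) (G : set (set T)) (f g : T -> R) : Prop :=
  [/\ P.-integrable setT (EFin \o f),
      P.-integrable setT (EFin \o g),
      g_sigma_algebra_preimage g `<=` G &
      forall A, G A -> (\int[P]_(w in A) (f w)%:E = \int[P]_(w in A) (g w)%:E)%E].

(* [g] is a version of the conditional probability P(A | G). *)
Definition is_cond_prob d (T : measurableType d) (R : realType)
    (P : probability T R) (G : set (set T)) (A : set T) (g : T -> R) : Prop :=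
  is_cond_exp P G (\1_A) g.

Definition indep d (T : measurableType d) (R : realType)
    (P : probability T R) (F1 F2 : set (set T)) : Prop :=
  forall A B, F1 A -> F2 B -> P (A `&` B) = (P A * P B)%E.

(* P(A `&` B | F3) = P(A | F3) P(B | F3) almost surely. Versions exist and are
   almost surely unique, so quantifying them existentially or universally is
   the same. *)
Definition cond_indep d (T : measurableType d) (R : realType)
    (P : probability T R) (F1 F2 F3 : set (set T)) : Prop :=
  forall A B, F1 A -> F2 B ->
  exists p q r : T -> R,
    [/\ is_cond_prob P F3 A p, is_cond_prob P F3 B q,
        is_cond_prob P F3 (A `&` B) r &
        {ae P, forall w, r w = p w * q w}].

Definition cylinders (R : realType) (J : Type) : set (set (J -> R)) :=
  \bigcup_(j in [set: J])
    preimage_set_system setT (fun x : J -> R => x j) measurable.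

Definition Rprod (R : realType) (J : Type) := g_sigma_algebraType (@cylinders R J).

(* [K] is a regular version of the conditional distribution of [Y] given [G]. *)
Definition is_cond_distribution d (T : measurableType d) (R : realType)
    (P : probability T R) (G : set (set T)) d' (S : measurableType d')
    (Y : T -> S) (K : T -> probability S R) : Prop :=
  forall B, measurable B -> is_cond_prob P G (Y @^-1` B) (fun w => fine (K w B)).

Definition is_product_prob (R : realType) (V : finType)
    (mu : probability (Rprod R V) R) (nu : V -> probability R R) : Prop :=
  forall B : V -> set R, (forall v, measurable (B v)) ->
    mu [set x : Rprod R V | forall v, B v (x v)] = (\prod_(v : V) nu v (B v))%E.

(* A process is [X : V -> int -> {RV P >-> R}], with [X v t] for X_v(t). *)

(* The law of the process on R^(V * Z) is invariant under time shifts. *)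
Definition stationary d (T : measurableType d) (R : realType)
    (P : probability T R) (V : finType) (X : V -> int -> {RV P >-> R}) : Prop :=
  forall (h : int) (B : set (Rprod R (V * int))), measurable B ->
    P [set w | B (fun vt => X vt.1 (vt.2 + h) w)] =
    P [set w | B (fun vt => X vt.1 vt.2 w)].

(* The sigma-algebra generated by X_v(s), v in A, s <= t. *)
Definition past d (T : measurableType d) (R : realType) (P : probability T R)
    (V : finType) (X : V -> int -> {RV P >-> R}) (A : {set V}) (t : int) :
    set (set T) :=
  sigma_family [set vs : V * int | vs.1 \in A /\ vs.2 <= t]
    (fun vs => X vs.1 vs.2 : T -> R).

(* Normal distributions on R, Dirac masses included: the library's
   [normal_prob m 0] is not the Dirac mass at m. *)
Definition is_gaussian_law (R : realType) (mu : set R -> \bar R) : Prop :=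
  exists m s : R, forall B : set R, measurable B ->
    mu B = if s == 0 then \d_m B else normal_prob m s B.

(* Every finite linear combination of the variables is Gaussian, that is, the
   finite-dimensional distributions are (possibly degenerate) multivariate
   normal. *)
Definition gaussian_process d (T : measurableType d) (R : realType)
    (P : probability T R) (V : finType) (X : V -> int -> {RV P >-> R}) : Prop :=
  forall (n : nat) (c : 'I_n -> R) (v : 'I_n -> V) (t : 'I_n -> int),
    is_gaussian_law
      (pushforward P (fun w => \sum_(j < n) c j * X (v j) (t j) w)).

Definition contemporaneously_independent d (T : measurableType d)
    (R : realType) (P : probability T R) (V : finType)
    (X : V -> int -> {RV P >-> R}) : Prop :=
  forall t : int,
  exists (K : T -> probability (Rprod R V) R) (k : V -> T -> probability R R),
    [/\ is_cond_distribution P (past X [set: V]%SET t)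
          (fun w => (fun v => X v (t + 1) w) : Rprod R V) K,
        forall v, is_cond_distribution P (past X [set: V]%SET t) (X v (t + 1)) (k v) &
        {ae P, forall w, is_product_prob (K w) (fun v => k v w)}].

(* [m v] is a version of E[X_v(t+1) | X_V(t)]; integrability of X_v(t+1) is part
   of [is_cond_exp]. *)
Definition past_only_in_mean d (T : measurableType d) (R : realType)
    (P : probability T R) (V : finType) (X : V -> int -> {RV P >-> R}) : Prop :=
  forall t : int,
  exists m : V -> T -> R,
    (forall v, is_cond_exp P (past X [set: V]%SET t) (X v (t + 1)) (m v)) /\
    indep P (sigma_family [set: V] (fun v w => X v (t + 1) w - m v w))
            (past X [set: V]%SET t).

Definition granger_noncausal d (T : measurableType d) (R : realType)
    (P : probability T R) (V : finType) (X : V -> int -> {RV P >-> R})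
    (A B : {set V}) : Prop :=
  forall t : int,
    cond_indep P (past X B (t + 1)) (past X A t) (past X (~: A)%SET t).

Definition contemp_noncausal d (T : measurableType d) (R : realType)
    (P : probability T R) (V : finType) (X : V -> int -> {RV P >-> R})
    (A B : {set V}) : Prop :=
  forall t : int,
    cond_indep P (past X A (t + 1)) (past X B (t + 1))
      (join_sigma (past X [set: V]%SET t) (past X (~: (A :|: B))%SET (t + 1))).

Definition pairwise_markov d (T : measurableType d) (R : realType)
    (P : probability T R) (V : finType) (G : mixed_graph V)
    (X : V -> int -> {RV P >-> R}) : Prop :=
  forall a b : V, a != b ->
    (~~ dedge G a b -> granger_noncausal X [set a]%SET [set b]%SET) /\
    (~~ uedge G a b -> contemp_noncausal X [set a]%SET [set b]%SET).

Definition local_markov d (T : measurableType d) (R : realType)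
    (P : probability T R) (V : finType) (G : mixed_graph V)
    (X : V -> int -> {RV P >-> R}) : Prop :=
  forall a : V,
    granger_noncausal X (~: (pa1 G a :|: [set a]))%SET [set a]%SET /\
    contemp_noncausal X (~: (ne1 G a :|: [set a]))%SET [set a]%SET.

Definition block_markov d (T : measurableType d) (R : realType)
    (P : probability T R) (V : finType) (G : mixed_graph V)
    (X : V -> int -> {RV P >-> R}) : Prop :=
  forall A : {set V},
    granger_noncausal X (~: (pa G A :|: A))%SET A /\
    contemp_noncausal X (~: (ne G A :|: A))%SET A.

(* Main.v *)
Require Import Defs.
From HB Require Import structures.
From mathcomp Require Import all_boot all_order all_algebra.
From mathcomp Require Import all_classical all_reals all_analysis.
From mathcomp Require Import measurable_realfun ring lra.

(** Every noncausality statement says that a conditional probability is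
    measurable with respect to less than what is conditioned upon. Write F_A(t)
    for [past X A t], past_next t A for F_V(t) joined with F_A(t+1), and [ci D G f]
    for the assertion that E[f | G] has a D-measurable version. Then X_A does
    not cause X_B iff P(E | F_V(t)) is F_(V\A)(t)-measurable for all E in
    F_B(t+1) ([granger_ci]), and X_A and X_B are contemporaneously noncausal iff
    P(E | past_next t (V\A)) is past_next t (V\(A u B))-measurable for all E in
    F_A(t+1) ([contemp_ci]). In this form the block-recursive property yields
    the local one, and the local one the pairwise one, by monotonicity.

    From pairwise to local, and for the contemporaneous half from local to
    block-recursive, the vertices are removed one at a time ([ci_setD]) by the
    intersection property [ci_intersection]: if E[f | G] has a version
    measurable for D1 and another one measurable for D2, the two agree almost
    surely, so both are measurable for the intersection of the completions of D1
    and D2, and measurable separability identifies this intersection.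

    The directed half from local to block-recursive needs composition
    ([composable]): if P(E | F_V(t)) is F_D(t)-measurable for the events of each
    single X_b, b in A, then so it is for the events of X_A. This fails for
    general processes, and it is the only place where the condition on the joint
    law of X_V(t+1) enters.

    Under contemporaneous independence the conditional probability of a box is
    the product of the conditional probabilities of its sides, each
    F_D(t)-measurable, and boxes generate ([contemp_indep_composable]). If the
    past enters in the mean only, then X_b(t+1) = eps_b + m_b with (eps_b)_b
    independent of F_V(t); the hypothesis on the single variable X_b makes m_b
    almost surely F_D(t)-measurable, so the events of X_A up to t+1 are, up to
    null sets, events of F_D(t) and of noise independent of F_V(t)
    ([past_only_composable]).

    A Gaussian process depends on its past in the mean only
    ([gaussian_past_only]). The centred X_v(t+1) is projected orthogonally on
    the closed linear span of the centred past; the projection is an almost sure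
    limit of finite combinations of past variables, hence F_V(t)-measurable, and
    the residual, being orthogonal to the past, has to be shown independent of
    it. For jointly Gaussian L and M with E[LM] = 0 the formulas E cos W = exp(-
    E[W^2] / 2) and E sin W = 0, applied to W = L + M and W = L - M, show that
    cos L and sin L are uncorrelated with cos M and sin M; a functional monotone
    class theorem ([bclos_indic_gt], [bclos_sigma]) passes from cosines and
    sines to the generated sigma-algebras. The two formulas come from the moment
    generating function by comparison of power series ([moment_coefE]). *)

Set Implicit Arguments.
Unset Strict Implicit.
Unset Printing Implicit Defensive.

Import Order.TTheory GRing.Theory Num.Theory.
Import numFieldNormedType.Exports.

Local Open Scope classical_set_scope.
Local Open Scope ring_scope.

(** * Functional monotone classes *)

(** The least linear space of functions containing [M] and closed under
    uniformly bounded pointwise limits. Identities between expectations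
    propagate from [M] to it by induction, and under the hypotheses of the
    section below it contains all bounded functions measurable for the
    sigma-algebra generated by [M]. *)
Inductive bclos (T : Type) (R : realType) (M : set (T -> R)) : (T -> R) -> Prop :=
| bclos_gen f : M f -> bclos M f
| bclos_lin (a b : R) f g : bclos M f -> bclos M g ->
    bclos M (fun x => a * f x + b * g x)
| bclos_lim (C : R) (u : nat -> T -> R) f : (forall n, bclos M (u n)) ->
    (forall n x, `|u n x| <= C) -> (forall x, u n x @[n --> \oo] --> f x) ->
    bclos M f.

Lemma cvg_norm_le (R : realType) (u : nat -> R) (l C : R) :
  (forall n, `|u n| <= C) -> u n @[n --> \oo] --> l -> `|l| <= C.
Proof.
move=> uC ul; rewrite -(cvg_lim (@Rhausdorff R) (cvg_norm ul)).
by apply: limr_le; [exact: is_cvg_norm (cvgP _ ul)|exact: nearW].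
Qed.

Section bounded_closure.
Context (T : Type) (R : realType) (M : set (T -> R)).
Hypothesis M1 : M (fun=> 1).
Hypothesis Mb : forall f, M f -> exists C : R, forall x, `|f x| <= C.
Hypothesis MM : forall f g, M f -> M g -> bclos M (fun x => f x * g x).

Lemma bclos_bounded f : bclos M f -> exists C : R, forall x, `|f x| <= C.
Proof.
elim=> {f} [f /Mb//|a b f g _ [C fC] _ [D gD]|C u f _ _ uC uf].
- exists (`|a| * C + `|b| * D) => x.
  rewrite (le_trans (ler_normD _ _))// !normrM lerD// ler_wpM2l//.
- by exists C => x; exact: cvg_norm_le (uf x).
Qed.

Lemma bclos_ext f g : bclos M f -> f =1 g -> bclos M g.
Proof. by move=> Mf fg; rewrite (_ : g = f)//; apply/funext => x; rewrite fg. Qed.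

Lemma bclos_cst c : bclos M (fun=> c).
Proof.
apply: (@bclos_ext _ _ (bclos_lin c 0 (bclos_gen M1) (bclos_gen M1))) => x /=.
by rewrite mul0r addr0 mulr1.
Qed.

Lemma bclos_sum n (c : 'I_n -> R) (f : 'I_n -> T -> R) :
  (forall i, M (f i)) -> bclos M (fun x => \sum_(i < n) c i * f i x).
Proof.
move=> Mf; elim: n c f Mf => [|n IH] c f Mf.
  by apply: (bclos_ext (bclos_cst 0)) => x; rewrite big_ord0.
have Mi := IH (fun i => c (lift ord0 i)) _ (fun i => Mf (lift ord0 i)).
apply: (bclos_ext (bclos_lin (c ord0) 1 (bclos_gen (Mf ord0)) Mi)) => x.
by rewrite mul1r big_ord_recl.
Qed.

(** Closure under products is bilinear, so it is enough to induct on one factor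
    at a time, starting from [M]. *)
Lemma bclosM f g : bclos M f -> bclos M g -> bclos M (fun x => f x * g x).
Proof.
move=> Mf; elim: Mf g => {f} [f Mf g Mg|a b f1 f2 _ IH1 _ IH2 g Mg|].
- elim: Mg f Mf => {g} [g Mg f Mf|a b g1 g2 _ IH1 _ IH2 f Mf|].
  + exact: MM.
  + apply: (bclos_ext (bclos_lin a b (IH1 _ Mf) (IH2 _ Mf))) => x; ring.
  + move=> C u g _ IH uC ug f Mf; have [D fD] := Mb Mf.
    apply: (@bclos_lim _ _ _ (D * C) (fun n x => f x * u n x)).
    * by move=> n; exact: IH.
    * by move=> n x; rewrite normrM ler_pM.
    * by move=> x; apply: cvgM; [exact: cvg_cst|exact: ug].
- apply: (bclos_ext (bclos_lin a b (IH1 _ Mg) (IH2 _ Mg))) => x; ring.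
- move=> C u f _ IH uC uf g Mg; have [D gD] := bclos_bounded Mg.
  apply: (@bclos_lim _ _ _ (C * D) (fun n x => u n x * g x)).
  * by move=> n; exact: IH.
  * by move=> n x; rewrite normrM ler_pM.
  * by move=> x; apply: cvgM; [exact: uf|exact: cvg_cst].
Qed.

Lemma bclosX f n : bclos M f -> bclos M (fun x => f x ^+ n).
Proof.
move=> Mf; elim: n => [|n IH]; first exact: bclos_cst.
by apply: (bclos_ext (bclosM Mf IH)) => x; rewrite exprS.
Qed.

(** The iteration s |-> s + (y^2 - s^2) / 2, which increases from 0 to |y| when
    |y| <= 1. Its terms are polynomials in y, which makes |y| a bounded limit of
    polynomials without the Weierstrass theorem. *)
Fixpoint abs_iter (y : R) n : R :=
  if n is n'.+1 then abs_iter y n' + (y ^+ 2 - abs_iter y n' ^+ 2) / 2 else 0.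

Lemma abs_iter_bounds y n : `|y| <= 1 -> 0 <= abs_iter y n <= `|y|.
Proof.
move=> y1; elim: n => [|n /=]; first by rewrite /= lexx normr_ge0.
rewrite -[y ^+ 2]real_normK ?num_real//.
set a := abs_iter y n; have := normr_ge0 y; set b := `|y| in y1 *.
move=> b0 /andP[a0 ab]; apply/andP; split; nra.
Qed.

Lemma abs_iter_cvg y : `|y| <= 1 -> abs_iter y n @[n --> \oo] --> `|y|.
Proof.
move=> y1.
have nd : nondecreasing_seq (abs_iter y).
  apply/nondecreasing_seqP => n /=; have /andP[a0 ab] := abs_iter_bounds n y1.
  rewrite -[y ^+ 2]real_normK ?num_real//; have := normr_ge0 y; nra.
have ub : has_ubound (range (abs_iter y)).
  by exists `|y| => _ [n _ <-]; have /andP[] := abs_iter_bounds n y1.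
have cv : cvgn (abs_iter y) by exact: nondecreasing_is_cvgn.
set l := limn (abs_iter y); have cl : abs_iter y n @[n --> \oo] --> l by exact: cv.
have l0 : 0 <= l.
  apply: limr_ge => //; apply: nearW => n; by have /andP[] := abs_iter_bounds n y1.
have : abs_iter y n.+1 @[n --> \oo] --> l by rewrite cvg_shiftS.
have : abs_iter y n.+1 @[n --> \oo] --> l + (y ^+ 2 - l ^+ 2) / 2.
  apply: cvgD => //; apply: cvgMl.
  by apply: cvgB; [exact: cvg_cst|rewrite !expr2; exact: cvgM].
move=> c1 c2; have e : l + (y ^+ 2 - l ^+ 2) / 2 = l by exact: (cvg_unique _ c1 c2).
have {}e : `|y| ^+ 2 = l ^+ 2.
  by rewrite real_normK ?num_real//; lra.
suff -> : `|y| = l by [].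
by apply/eqP; rewrite -(eqrXn2 (n:=2))//; apply/eqP.
Qed.

(** After rescaling [f] into [-1, 1] the polynomials [abs_iter] apply. *)
Lemma bclos_norm f : bclos M f -> bclos M (fun x => `|f x|).
Proof.
move=> Mf; have [C fC] := bclos_bounded Mf.
pose D := `|C| + 1; have D0 : 0 < D by rewrite /D ltr_wpDl.
have fD x : `|f x / D| <= 1.
  rewrite normrM normfV (gtr0_norm D0) ler_pdivrMr// mul1r.
  by rewrite (le_trans (fC x))// /D (le_trans (ler_norm _))// lerDl.
have Mg : bclos M (fun x => f x / D).
  by apply: (bclos_ext (bclos_lin D^-1 0 Mf Mf)) => x; rewrite mul0r addr0 mulrC.
have Ms n : bclos M (fun x => abs_iter (f x / D) n).
  elim: n => [|n IH] /=; first exact: bclos_cst.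
  apply: (bclos_ext (bclos_lin 1 2^-1 IH
    (bclos_lin 1 (-1) (bclosX 2 Mg) (bclosX 2 IH)))) => x.
  by rewrite /=; lra.
have Mn : bclos M (fun x => `|f x / D|).
  apply: (@bclos_lim _ _ _ 1 (fun n x => abs_iter (f x / D) n)) => //.
    move=> n x; have /andP[a b] := abs_iter_bounds n (fD x).
    by rewrite ger0_norm// (le_trans b).
  by move=> x; exact: abs_iter_cvg.
apply: (bclos_ext (bclos_lin D 0 Mn Mn)) => x.
by rewrite mul0r addr0 normrM normfV (gtr0_norm D0) mulrC divfK// gt_eqF.
Qed.

Lemma cvg_expr_lt1 (z : R) : 0 <= z -> z < 1 -> z ^+ n @[n --> \oo] --> (0 : R).
Proof. by move=> z0 z1; apply: cvg_expr; rewrite ger0_norm. Qed.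

(** For 0 <= g <= 1 the functions 1 - (1 - g)^n converge to the indicator of g
    != 0; here g is the square of [f], rescaled. *)
Lemma bclos_indic_neq0 f : bclos M f -> bclos M (\1_[set x | f x != 0]).
Proof.
move=> Mf; have [C fC] := bclos_bounded Mf.
pose D := `|C| + 1; have D0 : 0 < D by rewrite /D ltr_wpDl.
pose g x := (f x / D) ^+ 2.
have g01 x : 0 <= g x <= 1.
  rewrite sqr_ge0/= /g -real_normK ?num_real// expr_le1//.
  rewrite normrM normfV (gtr0_norm D0) ler_pdivrMr// mul1r.
  by rewrite (le_trans (fC x))// /D (le_trans (ler_norm _))// lerDl.
have Mg : bclos M g.
  apply: bclosX.
  by apply: (bclos_ext (bclos_lin D^-1 0 Mf Mf)) => x; rewrite mul0r addr0 mulrC.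
apply: (@bclos_lim _ _ _ 1 (fun n x => 1 - (1 - g x) ^+ n)).
- move=> n; have M1g := bclos_lin 1 (-1) (bclos_cst 1) Mg.
  apply: (bclos_ext (bclos_lin 1 (-1) (bclos_cst 1) (bclosX n M1g))) => x /=.
  by rewrite !mul1r !mulN1r.
- move=> n x; have /andP[a b] := g01 x.
  have h0 : 0 <= (1 - g x) ^+ n by rewrite exprn_ge0// subr_ge0.
  have h1 : (1 - g x) ^+ n <= 1 by rewrite exprn_ile1 ?subr_ge0// lerBlDr lerDl.
  by rewrite ger0_norm; lra.
- move=> x; rewrite indicE; have [fx|fx] := eqVneq (f x) 0.
    rewrite memNset/=; last by rewrite fx eqxx.
    rewrite (_ : (fun n => _) = fun=> 0); first exact: cvg_cst.
    by apply/funext => n; rewrite /g fx mul0r expr0n/= subr0 expr1n subrr.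
  rewrite mem_set//=.
  suff : 1 - (1 - g x) ^+ n @[n --> \oo] --> 1 - (0 : R) by rewrite subr0.
  apply: cvgB; first exact: cvg_cst.
  have /andP[a b] := g01 x; apply: cvg_expr_lt1; first by rewrite subr_ge0.
  rewrite ltrBlDr ltrDl lt_neqAle a andbT eq_sym /g sqrf_eq0 mulf_neq0//.
  by rewrite invr_eq0 gt_eqF.
Qed.

(** The set where h = f - a is positive is the set where h + |h| does not
    vanish. *)
Lemma bclos_indic_gt f a : bclos M f -> bclos M (\1_[set x | a < f x]).
Proof.
move=> Mf.
have Mg := bclos_lin 1 (-1) Mf (bclos_cst a).
have := bclos_indic_neq0 (bclos_lin 1 1 Mg (bclos_norm Mg)).
congr bclos; congr indic; apply/seteqP; split => x /=;
  rewrite !mul1r mulN1r; have [h|h] := lerP (f x - a) 0.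
- by rewrite ler0_norm// addrN eqxx.
- by move=> _; rewrite -subr_gt0.
- by rewrite -subr_gt0 ltNge h.
- by move=> _; rewrite gt_eqF// gtr0_norm// addr_gt0.
Qed.

(** Complements come from linearity, finite unions from [bclos_indic_neq0]
    applied to the sum of the indicators, countable unions from bounded limits. *)
Lemma bclos_sigma : sigma_algebra setT [set A | bclos M (\1_A)].
Proof.
split => /=.
- by rewrite indic0; exact: bclos_cst.
- move=> A MA.
  apply: (bclos_ext (bclos_lin 1 (-1) (bclos_cst 1) MA)) => x /=.
  rewrite !mul1r mulN1r !indicE.
  by rewrite setTD in_setC; case: (x \in A); rewrite ?subrr ?subr0.
- move=> F MF.
  have MU n : bclos M (\1_(\big[setU/set0]_(i < n) F i)).
    elim: n => [|n IH]; first by rewrite big_ord0 indic0; exact: bclos_cst.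
    rewrite big_ord_recr/=.
    have := bclos_indic_neq0 (bclos_lin 1 1 IH (MF n)).
    congr bclos; congr indic; apply/seteqP; split => x /=; rewrite !mul1r !indicE.
      have [/set_mem ? _|_] := boolP (x \in \big[setU/set0]_(i < n) F i); first by left.
      by have [/set_mem ? _|_] := boolP (x \in F n); [right|rewrite addr0 eqxx].
    case=> [/mem_set -> | /mem_set ->]; by case: (x \in _); rewrite /= -?natrD pnatr_eq0.
  apply: (@bclos_lim _ _ _ 1 (fun n => \1_(\big[setU/set0]_(i < n) F i))) => //.
    by move=> n x; rewrite indicE; case: (_ \in _); rewrite /= ?normr1 ?normr0.
  move=> x; rewrite [X in _ --> X]indicE.
  have [/set_mem[k _ Fk]|/negP xF] := boolP (x \in _).
    apply: cvg_near_cst; near=> n; rewrite indicE mem_set//.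
    rewrite -bigcup_mkord; exists k => //=.
    by near: n; exists k.+1.
  apply: cvg_near_cst; near=> n; rewrite indicE memNset//.
  rewrite -bigcup_mkord => -[k _ Fk]; apply: xF; rewrite inE; by exists k.
Unshelve. all: by end_near. Qed.

End bounded_closure.

Definition mble (T : Type) (R : realType) (G : set (set T)) (f : T -> R) :=
  forall B, measurable B -> G (f @^-1` B).

Import HBNNSimple.
Section mble_closure.
Context (T : pointedType) (R : realType) (G : set (set T)).
Hypothesis sG : sigma_algebra setT G.

(** Gives access to the measurability theorems for real functions, applied on
    the type [T] equipped with the sigma-algebra [G]. *)
Lemma mbleP (f : T -> R) :
  mble G f <-> measurable_fun [set: g_sigma_algebraType G] (f : g_sigma_algebraType G -> R).
Proof.
split=> [Gf _ B mB|mf B mB].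
  by rewrite setTI /measurable/= sigma_algebra_id//; exact: Gf.
have := mf measurableT B mB.
by rewrite setTI /measurable/= sigma_algebra_id.
Qed.

Definition indics : set (T -> R) := [set f | exists2 A, G A & f = \1_A].

Lemma indics1 : indics (fun=> 1).
Proof.
exists setT; last by rewrite indicT.
by case: sG => G0 GD _; rewrite -(setD0 setT); exact: GD.
Qed.

(** The shifted function f + C is nonnegative and thus an increasing limit of
    simple functions, bounded by 2C. *)
Lemma bclos_mble (f : T -> R) (C : R) : mble G f -> (forall x, `|f x| <= C) ->
  bclos indics f.
Proof.
move=> /mbleP mf fC.
pose h (x : g_sigma_algebraType G) : \bar R := (f x + C)%:E.
have mh : measurable_fun [set: g_sigma_algebraType G] h.
  by apply/measurable_EFinP; apply: measurable_funD => //; exact: measurable_cst.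
have h0 x : [set: g_sigma_algebraType G] x -> (0 <= h x)%E.
  move=> _; rewrite lee_fin; have := fC x; rewrite ler_norml => /andP[+ _]; lra.
pose g := nnsfun_approx measurableT mh.
have gh n x : ((g n x)%:E <= h x)%E by rewrite nnsfun_approxE; exact: le_approx.
have Mg n : bclos indics (g n : T -> R).
  refine (bclos_ext _ (fun x => esym (fimfunEord (g n) x))).
  apply: (bclos_sum indics1) => i; eexists; last by [].
  have := measurable_funPTI (g n) (measurable_set1 (finmap.enum_fset (fset_set (range (g n))))`_i).
  by rewrite /measurable/= sigma_algebra_id.
have M2 : bclos indics (fun x => f x + C).
  apply: (@bclos_lim _ _ _ (`|C| + C) (fun n x => g n x)) => //.
    move=> n x; rewrite ger0_norm//.
    have := gh n x; rewrite lee_fin => /le_trans; apply; rewrite lerD2r.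
    by rewrite (le_trans (ler_norm _))// (le_trans (fC x))// ler_norm.
  move=> x; have := @cvg_nnsfun_approx _ _ _ _ measurableT _ mh h0 x Logic.I.
  by move=> /fine_cvgP[_]; apply: cvg_trans.
by apply: (bclos_ext (bclos_lin 1 (-1) M2 (bclos_cst indics1 C))) => x; ring.
Qed.

End mble_closure.

(** * Expectations *)

Section expectation.
Context d (T : measurableType d) (R : realType) (P : probability T R).

(** Real-valued; statements about it require integrability, for which [integ]
    and [bmeas] are the working predicates. *)
Definition Ex (f : T -> R) : R := \int[P]_x f x.
Definition integ (f : T -> R) := P.-integrable setT (EFin \o f).
Definition bmeas (f : T -> R) := measurable_fun setT f /\ exists C : R, forall x, `|f x| <= C.

Lemma integ_meas f : integ f -> measurable_fun setT f.
Proof. by move/integrableP => [/measurable_EFinP]. Qed.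

Lemma bmeas_bounded (f : T -> R) : bmeas f -> [bounded f x | x in [set: T]].
Proof.
move=> [_ [C fC]]; exists C; split; first exact: num_real.
by move=> M CM x _ /=; rewrite (le_trans (fC x))// ltW.
Qed.

Lemma bmeas_integ f : bmeas f -> integ f.
Proof.
move=> bf; apply: measurable_bounded_integrable => //.
- by apply: (@le_lt_trans _ _ 1%E); [exact: probability_le1|exact: ltry].
- by case: bf.
- exact: bmeas_bounded.
Qed.

Lemma bmeas_cst c : bmeas (fun=> c).
Proof. by split; [exact: measurable_cst|exists `|c|]. Qed.

Lemma bmeas_indic A : measurable A -> bmeas (\1_A).
Proof.
move=> mA; split; first exact: measurable_indic.
by exists 1 => x; rewrite indicE; case: (_ \in _); rewrite /= ?normr1 ?normr0.
Qed.

Lemma bmeasM f g : bmeas f -> bmeas g -> bmeas (fun x => f x * g x).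
Proof.
move=> [mf [C fC]] [mg [D gD]]; split; first exact: measurable_funM.
by exists (C * D) => x; rewrite normrM ler_pM.
Qed.

Lemma bmeas_lin a b f g : bmeas f -> bmeas g -> bmeas (fun x => a * f x + b * g x).
Proof.
move=> [mf [C fC]] [mg [D gD]]; split.
  by apply: measurable_funD; apply: measurable_funM => //; exact: measurable_cst.
exists (`|a| * C + `|b| * D) => x.
by rewrite (le_trans (ler_normD _ _))// !normrM lerD// ler_wpM2l.
Qed.

Lemma integ_lin a b f g : integ f -> integ g -> integ (fun x => a * f x + b * g x).
Proof.
move=> If Ig.
have := integrableD measurableT (integrableZl measurableT a If) (integrableZl measurableT b Ig).
by apply: eq_integrable.
Qed.

Lemma integM f g : bmeas f -> integ g -> integ (fun x => f x * g x).
Proof.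
move=> bf Ig.
have := integrableMr measurableT bf.1 (bmeas_bounded bf) Ig.
by apply: eq_integrable.
Qed.

Lemma Ex_lin a b f g : integ f -> integ g ->
  Ex (fun x => a * f x + b * g x) = a * Ex f + b * Ex g.
Proof.
move=> If Ig; rewrite /Ex RintegralD//.
- by rewrite !RintegralZl.
- by have := integ_lin a 0 If If; apply: eq_integrable => // x _ /=; rewrite mul0r addr0.
- by have := integ_lin b 0 Ig Ig; apply: eq_integrable => // x _ /=; rewrite mul0r addr0.
Qed.

Lemma Ex_ext f g : f =1 g -> Ex f = Ex g.
Proof. by move=> fg; rewrite (_ : f = g)//; exact/funext. Qed.

Lemma integ_ext f g : f =1 g -> integ f -> integ g.
Proof. by move=> fg; rewrite (_ : f = g)//; exact/funext. Qed.

Lemma Ex_ae f g : measurable_fun setT f -> measurable_fun setT g ->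
  {ae P, forall x, f x = g x} -> Ex f = Ex g.
Proof.
move=> mf mg fg; congr fine; apply: ae_eq_integral => //.
- exact/measurable_EFinP.
- exact/measurable_EFinP.
- by apply: filterS fg => x fgx _ /=; rewrite fgx.
Qed.

Lemma Ex_dct_ae (u : nat -> T -> R) (f g : T -> R) : (forall n, measurable_fun setT (u n)) ->
  measurable_fun setT f -> integ g ->
  {ae P, forall x, u n x @[n --> \oo] --> f x} ->
  {ae P, forall x, forall n, `|u n x| <= g x} ->
  integ f /\ Ex (u n) @[n --> \oo] --> Ex f.
Proof.
move=> mu mf Ig uf ug.
have [||||If _ cv] := @dominated_convergence _ _ _ P setT measurableT
  (fun n => EFin \o u n) (EFin \o f) (EFin \o g) _ _ _ Ig.
- by move=> n; exact/measurable_EFinP.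
- exact/measurable_EFinP.
- apply: filterS uf => x ufx _; apply: cvg_EFin; [exact: nearW|exact: ufx].
- by apply: filterS ug => x ugx n _ /=; rewrite lee_fin.
split => //; apply: fine_cvg; rewrite fineK//; exact: integrable_fin_num.
Qed.

Lemma Ex_dct (u : nat -> T -> R) (f g : T -> R) : (forall n, measurable_fun setT (u n)) ->
  integ g -> (forall x, u n x @[n --> \oo] --> f x) ->
  (forall n x, `|u n x| <= g x) ->
  integ f /\ Ex (u n) @[n --> \oo] --> Ex f.
Proof.
move=> mu Ig uf ug; apply: (@Ex_dct_ae u f g) => //; [|exact: aeW|exact: aeW].
by apply: (measurable_fun_cvg (h := u)) => // x _.
Qed.

Lemma le_Ex f g : integ f -> integ g -> (forall x, f x <= g x) -> Ex f <= Ex g.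
Proof. by move=> If Ig fg; apply: le_Rintegral. Qed.

Lemma Ex_ge0 f : (forall x, 0 <= f x) -> 0 <= Ex f.
Proof. by move=> f0; exact: Rintegral_ge0. Qed.

Lemma Ex_cst c : Ex (fun=> c) = c.
Proof.
rewrite /Ex Rintegral_cst// [X in _ * X](_ : _ = 1) ?mulr1//.
by rewrite -[RHS]/(fine 1%:E); congr fine; exact: probability_setT.
Qed.

Lemma Ex_indic A : measurable A -> Ex (\1_A) = fine (P A).
Proof. by move=> mA; rewrite /Ex /Rintegral integral_indic// setIT. Qed.

Lemma integral_Ex A f : measurable A -> integ f ->
  (\int[P]_(w in A) (f w)%:E)%E = (Ex (fun x => \1_A x * f x))%:E.
Proof.
move=> mA If; rewrite /Ex /Rintegral fineK; last first.
  by apply: integrable_fin_num => //; apply: integM => //; exact: bmeas_indic.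
rewrite [LHS]integral_mkcond; apply: eq_integral => x _.
by rewrite patchE indicE; case: ifP => _; rewrite ?mul1r ?mul0r.
Qed.

Lemma Ex_eq0 f : integ f -> (forall x, 0 <= f x) -> Ex f = 0 ->
  {ae P, forall x, f x = 0}.
Proof.
move=> If f0 Ef.
have := (ae_eq_integral_abs P measurableT (measurable_int _ If)).1.
have -> : (\int[P]_x `|(EFin \o f) x| = 0)%E.
  rewrite -[RHS]/((0 : R)%:E) -Ef /Ex /Rintegral fineK; last exact: integrable_fin_num.
  by apply: eq_integral => x _ /=; rewrite ger0_norm.
by move=> /(_ erefl); apply: filterS => x /(_ Logic.I) [].
Qed.

Lemma ExZr f c : integ f -> Ex (fun x => f x * c) = Ex f * c.
Proof. by move=> If; rewrite /Ex RintegralZr. Qed.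

(** Both sides are linear in [h] and pass to uniformly bounded limits by
    dominated convergence. *)
Lemma bclos_Ex (K : set (T -> R)) f g : integ f -> integ g ->
  (forall h, K h -> bmeas h /\ Ex (fun x => h x * f x) = Ex (fun x => h x * g x)) ->
  forall h, bclos K h -> bmeas h /\ Ex (fun x => h x * f x) = Ex (fun x => h x * g x).
Proof.
move=> If Ig Kfg h.
elim=> {h} [h /Kfg//|a b h1 h2 _ [b1 e1] _ [b2 e2]|C u h _ IH uC uh].
  split; first exact: bmeas_lin.
  have E f' : integ f' -> Ex (fun x => (a * h1 x + b * h2 x) * f' x) =
      a * Ex (fun x => h1 x * f' x) + b * Ex (fun x => h2 x * f' x).
    move=> If'; rewrite -Ex_lin; [|exact: integM..].
    by apply: Ex_ext => x; rewrite mulrDl !mulrA.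
  by rewrite !E// e1 e2.
split; first split.
- by apply: (measurable_fun_cvg (h := u)) => // n; case: (IH n) => -[].
- by exists C => x; exact: cvg_norm_le (uh x).
have E f' : integ f' -> Ex (fun x => u n x * f' x) @[n --> \oo] --> Ex (fun x => h x * f' x).
  move=> If'.
  have [] // := @Ex_dct (fun n x => u n x * f' x) (fun x => h x * f' x)
    (fun x => C * `|f' x|).
  - move=> n; apply: measurable_funM; first by case: (IH n) => -[].
    exact: integ_meas If'.
  - exact: integM (bmeas_cst C) (integrable_norm If').
  - by move=> x; apply: cvgM => //; exact: cvg_cst.
  - by move=> n x; rewrite normrM ler_wpM2r.
apply: (cvg_unique _ (E f If)) => //.
rewrite (_ : (fun n => _) = fun n => Ex (fun x => u n x * g x)); first exact: E.
by apply/funext => n; case: (IH n).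
Qed.

End expectation.

(** * Conditional expectations *)

Section charge_on_sub.
Context d d' (T : measurableType d) (T' : measurableType d') (R : realType).
Context (P : probability T R) (X : {mfun T >-> T'}) (f : T -> \bar R).
Hypothesis intf : P.-integrable setT f.

(** The signed measure A |-> E[f; X in A] on the target of [X]. With [X] the
    identity of [T], seen as a map to [T] with a smaller sigma-algebra, its
    Radon-Nikodym derivative is a conditional expectation of [f]. *)
Definition push_induced : set T' -> \bar R := pushforward (induced_charge intf) X.

Let nu0 : push_induced set0 = 0%E.
Proof. exact: charge0. Qed.

Let nufin A : measurable A -> push_induced A \is a fin_num.
Proof.
move=> mA; rewrite /push_induced /pushforward.
by apply: fin_num_measure; exact: measurable_funPTI.
Qed.

Let nuadd : semi_sigma_additive push_induced.
Proof.
move=> F mF tF mUF; rewrite /push_induced /pushforward preimage_bigcup.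
apply: charge_semi_sigma_additive.
- by move=> n; exact: measurable_funPTI.
- apply/trivIsetP => /= i j _ _ ij; rewrite -preimage_setI.
  by move/trivIsetP : tF => /(_ _ _ _ _ ij) ->//; rewrite preimage_set0.
- by rewrite -preimage_bigcup; exact: measurable_funPTI.
Qed.

HB.instance Definition _ := isCharge.Build _ _ _ push_induced nu0 nufin nuadd.

Lemma push_induced_dominates : push_induced `<< distribution P X.
Proof.
apply/null_content_dominatesP => A mA PA.
rewrite /push_induced /pushforward /induced_charge.
apply: null_set_integral => //; first exact: measurable_funPTI.
by apply: measurable_funTS; exact: measurable_int intf.
Qed.

End charge_on_sub.

Section sub_sigma_algebras.
Context d (T : measurableType d) (R : realType) (P : probability T R).
Implicit Types (f g h : T -> R).

Definition sub_sigma (G : set (set T)) := sigma_algebra setT G /\ G `<=` measurable.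

Lemma mble_meas G f : sub_sigma G -> mble G f -> measurable_fun setT f.
Proof. by move=> [_ sG] Gf _ B mB; rewrite setTI; exact/sG/Gf. Qed.

Lemma mble_sub G G' f : G `<=` G' -> mble G f -> mble G' f.
Proof. by move=> GG Gf B mB; exact/GG/Gf. Qed.

Section mble_ops.
Variable G : set (set T).
Hypothesis sG : sub_sigma G.
Let saG := sG.1.

Lemma sub_sigmaT : G setT.
Proof. by case: saG => G0 GD _; rewrite -(setD0 setT); exact: GD. Qed.

Lemma sub_sigmaC A : G A -> G (~` A).
Proof. by case: saG => _ GD _ GA; rewrite -setTD; exact: GD. Qed.

Lemma sub_sigmaI A B : G A -> G B -> G (A `&` B).
Proof.
move=> GA GB; have : measurable ((A : set (g_sigma_algebraType G)) `&` B).
  by apply: measurableI; rewrite /measurable/= sigma_algebra_id.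
by rewrite /measurable/= sigma_algebra_id.
Qed.

Lemma sub_sigmaE : <<s G >> = G. Proof. exact: sigma_algebra_id. Qed.

Lemma sub_sigma_gen : (measurable : set (set (g_sigma_algebraType G))) = G.
Proof. exact: sub_sigmaE. Qed.

Lemma mble_cst (c : R) : mble G (fun _ : T => c).
Proof. by apply/mbleP => //; exact: measurable_cst. Qed.

Lemma mbleD f g : mble G f -> mble G g -> mble G (fun x => f x + g x).
Proof. by move=> /(mbleP saG) ? /(mbleP saG) ?; apply/mbleP => //; exact: measurable_funD. Qed.

Lemma mbleM f g : mble G f -> mble G g -> mble G (fun x => f x * g x).
Proof. by move=> /(mbleP saG) ? /(mbleP saG) ?; apply/mbleP => //; exact: measurable_funM. Qed.

Lemma mble_comp (phi : R -> R) f : measurable_fun setT phi -> mble G f ->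
  mble G (phi \o f).
Proof.
move=> mphi Gf B mB; rewrite comp_preimage; apply: Gf.
by rewrite -[X in measurable X]setTI; exact: mphi.
Qed.

Lemma mble_lin a b f g : mble G f -> mble G g -> mble G (fun x => a * f x + b * g x).
Proof. by move=> Gf Gg; apply: mbleD; apply: mbleM => //; exact: mble_cst. Qed.

Lemma mble_indic A : G A -> mble G (\1_A : T -> R).
Proof.
by move=> GA; apply/mbleP => //; apply: measurable_indic; rewrite /measurable/= sub_sigmaE.
Qed.

Lemma mble_lt f g : mble G f -> mble G g -> G [set x | f x < g x].
Proof.
move=> Gf Gg; have GB := mble_lin 1 (-1) Gg Gf.
have := GB _ (@measurable_itv _ `]0, +oo[).
congr G; apply/seteqP; split => x /=; rewrite in_itv/= andbT mul1r mulN1r subr_gt0//.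
Qed.

End mble_ops.

Lemma sub_sigma_gen_sub G : G `<=` measurable -> sub_sigma <<s G >>.
Proof.
move=> sG; split; first exact: smallest_sigma_algebra.
by apply: smallest_sub => //; exact: sigma_algebra_measurable.
Qed.

Definition clip (C x : R) : R := Num.min C (Num.max (- C) x).

Lemma clip_le C x : 0 <= C -> `|clip C x| <= C.
Proof.
move=> C0; rewrite /clip ler_norml ge_min lexx/= andbT le_min le_max lexx/= andbT.
by rewrite (le_trans _ C0)// oppr_le0.
Qed.

Lemma clip_id C x : `|x| <= C -> clip C x = x.
Proof. by rewrite ler_norml => /andP[a b]; rewrite /clip max_r// min_r. Qed.

Lemma clip_norm C x : 0 <= C -> `|clip C x| <= `|x|.
Proof.
move=> C0; have [xC|Cx] := leP `|x| C; first by rewrite clip_id.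
by rewrite (le_trans (clip_le _ C0))// ltW.
Qed.

Lemma clip_cvg x : clip n%:R x @[n --> \oo] --> x.
Proof.
apply: cvg_near_cst; near=> n; rewrite clip_id//.
by near: n; exact: nbhs_infty_ger.
Unshelve. all: by end_near. Qed.

Lemma measurable_clip C : measurable_fun setT (clip C).
Proof.
apply: measurable_minr; first exact: measurable_cst.
by apply: measurable_maxr => //; exact: measurable_cst.
Qed.

(** The derivative of [push_induced] with respect to the restriction of [P] to
    [G]. *)
Lemma cond_exp_exists G f : sub_sigma G -> integ P f ->
  exists g, [/\ mble G g, integ P g &
    forall A, G A -> Ex P (fun x => \1_A x * f x) = Ex P (fun x => \1_A x * g x)].
Proof.
move=> sG If.
have mid : measurable_fun [set: T] (idfun : T -> g_sigma_algebraType G).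
  by move=> _ B; rewrite setTI sub_sigma_gen//; exact: sG.2.
pose X : {mfun T >-> g_sigma_algebraType G} := mfun_Sub (mem_set mid).
pose nu := push_induced X If; pose mu := distribution P X.
have numu : nu `<< mu by exact: push_induced_dominates.
pose h : g_sigma_algebraType G -> \bar R := Radon_Nikodym nu mu.
have hfin x : h x \is a fin_num by exact: Radon_Nikodym_fin_num.
have hint : mu.-integrable setT h by exact: Radon_Nikodym_integrable.
pose g : T -> R := fun x => fine (h x).
have mh : measurable_fun [set: g_sigma_algebraType G] h by exact: measurable_int hint.
have gh : EFin \o g = h by apply/funext => x /=; rewrite fineK.
have Gg : mble G g.
  apply/mbleP; first exact: sG.1.
  by apply/measurable_EFinP; rewrite gh.
have mg := mble_meas sG Gg.
have Ig : integ P g.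
  apply/integrableP; split; first exact/measurable_EFinP.
  have /integrableP[_] := hint.
  rewrite ge0_integral_distribution//; last exact: measurableT_comp.
  by rewrite -gh.
exists g; split => // A GA.
have mA : measurable A by exact: sG.2.
apply: EFin_inj; rewrite -!integral_Ex//.
have mA' : measurable (A : set (g_sigma_algebraType G)) by rewrite sub_sigma_gen.
have := Radon_Nikodym_integral numu mA'.
rewrite -[LHS]/((\int[P]_(w in A) (f w)%:E)%E) => ->.
rewrite -[RHS]/((\int[P]_(w in X @^-1` A) ((EFin \o g) w))%E) gh.
rewrite -/h -[LHS]/(\int[pushforward P X]_(x in (A : set (g_sigma_algebraType G))) h x)%E.
rewrite integral_pushforward//.
apply: (integrableS measurableT) => //.
by rewrite -[X in _.-integrable _ X]gh.
Qed.

(** The set A where g < f belongs to [G], so that (f - g) 1_A is nonnegative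
    with vanishing expectation; then the roles of f and g are exchanged. *)
Lemma cond_exp_unique G f g : sub_sigma G -> mble G f -> mble G g -> integ P f -> integ P g ->
  (forall A, G A -> Ex P (fun x => \1_A x * f x) = Ex P (fun x => \1_A x * g x)) ->
  {ae P, forall x, f x = g x}.
Proof.
move=> sG.
have half f' g' : mble G f' -> mble G g' -> integ P f' -> integ P g' ->
    (forall A, G A -> Ex P (fun x => \1_A x * f' x) = Ex P (fun x => \1_A x * g' x)) ->
    {ae P, forall x, f' x <= g' x}.
  move=> Gf Gg If Ig fg; pose A := [set x | g' x < f' x].
  have GA : G A by exact: mble_lt.
  have bA : bmeas (\1_A : T -> R) by apply: bmeas_indic; exact: sG.2.
  have := @Ex_eq0 _ _ _ P (fun x => 1 * (\1_A x * f' x) + (-1) * (\1_A x * g' x)).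
  have h0 x : 0 <= 1 * (\1_A x * f' x) + (-1) * (\1_A x * g' x) :> R.
    rewrite indicE; have [/set_mem /= xA|xA] := boolP (x \in A).
      by rewrite !mul1r mulN1r subr_ge0 ltW.
    by rewrite !mul0r !mulr0 addr0.
  move=> /(_ (integ_lin _ _ (integM bA If) (integM bA Ig)) h0).
  rewrite Ex_lin; [|exact: integM..].
  rewrite fg// mul1r mulN1r subrr => /(_ erefl).
  apply: filterS => x; rewrite indicE; have [/set_mem /= xA|xA] := boolP (x \in A).
    by rewrite !mul1r mulN1r => /eqP; rewrite subr_eq0 => /eqP ->.
  by move=> _; rewrite leNgt; apply: contra xA => xA; rewrite inE.
move=> Gf Gg If Ig fg; have := half f g Gf Gg If Ig fg.
have := half g f Gg Gf Ig If (fun A GA => esym (fg A GA)).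
by apply: filterS2 => x a b; apply/eqP; rewrite eq_le a b.
Qed.

(** The hypothesis extends from indicators of sets of [G] to their closure
    [bclos]. *)
Lemma pull_out_bounded G f g h : sub_sigma G -> integ P f -> integ P g -> mble G h ->
  (exists C, forall x, `|h x| <= C) ->
  (forall A, G A -> Ex P (fun x => \1_A x * f x) = Ex P (fun x => \1_A x * g x)) ->
  Ex P (fun x => h x * f x) = Ex P (fun x => h x * g x).
Proof.
move=> sG If Ig Gh [C hC] fg.
have [] // := @bclos_Ex _ _ _ P (indics G) f g If Ig _ h (bclos_mble sG.1 Gh hC).
by move=> _ [A GA ->]; split; [apply: bmeas_indic; exact: sG.2|exact: fg].
Qed.

(** The factor [h] is truncated by [clip], and the truncation is removed by
    dominated convergence; boundedness of [f] and [g] provides the dominating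
    function. *)
Lemma pull_out_integrable G f g h : sub_sigma G -> bmeas f -> bmeas g -> mble G h ->
  integ P h ->
  (forall A, G A -> Ex P (fun x => \1_A x * f x) = Ex P (fun x => \1_A x * g x)) ->
  Ex P (fun x => h x * f x) = Ex P (fun x => h x * g x).
Proof.
move=> sG bf bg Gh Ih fg.
have E f' : bmeas f' -> Ex P (fun x => clip n%:R (h x) * f' x) @[n --> \oo] --> Ex P (fun x => h x * f' x).
  move=> bf'; have [C fC] := bf'.2.
  have [] // := @Ex_dct _ _ _ P (fun n x => clip n%:R (h x) * f' x) (fun x => h x * f' x)
      (fun x => C * `|h x|).
  - move=> n; apply: measurable_funM; last exact: bf'.1.
    by apply: (measurableT_comp (measurable_clip _)); exact: integ_meas Ih.
  - by have := integM (bmeas_cst _ C) (integrable_norm Ih).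
  - by move=> x; apply: cvgM; [exact: clip_cvg|exact: cvg_cst].
  - by move=> n x; rewrite normrM mulrC ler_pM// clip_norm.
apply: (cvg_unique _ (E f bf)) => //.
rewrite (_ : (fun n => _) = fun n => Ex P (fun x => clip n%:R (h x) * g x)); first exact: E.
apply/funext => n; apply: (@pull_out_bounded G) => //.
- exact: bmeas_integ.
- exact: bmeas_integ.
- exact: (mble_comp (measurable_clip _)).
- by exists n%:R => x; exact: clip_le.
Qed.

(** A version [g] satisfies |g| <= C almost surely, because (g - C) 1_(C < g) is
    nonnegative with expectation at most 0, and likewise for - g; so clipping
    [g] changes it on a null set only, and [g] remains [G]-measurable. *)
Lemma cond_exp_exists_bounded G f C : sub_sigma G -> measurable_fun setT f -> (forall x, `|f x| <= C) ->
  exists g, [/\ mble G g, (forall x, `|g x| <= C) &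
    forall A, G A -> Ex P (fun x => \1_A x * f x) = Ex P (fun x => \1_A x * g x)].
Proof.
move=> sG mf fC; have bf : bmeas f by split => //; exists C.
have If := bmeas_integ P bf.
have C0 : 0 <= C := le_trans (normr_ge0 (f point)) (fC point).
have [g [Gg Ig fg]] := cond_exp_exists sG If.
(* s = 1 gives the upper bound, s = -1 the lower one *)
have half (s : R) : `|s| = 1 -> {ae P, forall x, s * g x <= C}.
  move=> s1; have ss : s * s = 1 by rewrite -expr2 -real_normK ?num_real// s1 expr1n.
  pose A := [set x | C < s * g x].
  have GA : G A.
    by apply: mble_lt => //; [exact: mble_cst|apply: mbleM => //; exact: mble_cst].
  have bA : bmeas (\1_A : T -> R) by apply: bmeas_indic; exact: sG.2.
  pose k x := \1_A x * (s * g x - C) : R.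
  have Ik : integ P k.
    apply: integM => //; have := integ_lin s (-1) Ig (bmeas_integ P (bmeas_cst _ C)).
    by apply: integ_ext => x; rewrite mulN1r.
  have k0 x : 0 <= k x.
    rewrite /k indicE; have [/set_mem /= xA|xA] := boolP (x \in A).
      by rewrite mul1r subr_ge0 ltW.
    by rewrite mul0r.
  have Ek : Ex P k = 0.
    apply/eqP; rewrite eq_le Ex_ge0// andbT.
    have -> : Ex P k = s * Ex P (fun x => \1_A x * g x) + (- C) * Ex P (\1_A : T -> R).
      rewrite -Ex_lin; [|exact: integM|exact: bmeas_integ].
      by apply: Ex_ext => x; rewrite /k; ring.
    rewrite -fg// -Ex_lin; [|exact: integM|exact: bmeas_integ].
    rewrite -[leRHS](Ex_cst P); apply: le_Ex.
    - by apply: integ_lin; [exact: integM|exact: bmeas_integ].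
    - by apply: bmeas_integ; exact: bmeas_cst.
    move=> x; rewrite (_ : _ + _ = \1_A x * (s * f x - C)); last by ring.
    rewrite mulr_ge0_le0//.
    by rewrite subr_le0 (le_trans (ler_norm _))// normrM s1 mul1r.
  apply: filterS (Ex_eq0 Ik k0 Ek) => x; rewrite /k indicE.
  have [/set_mem /= xA|xA _] := boolP (x \in A).
    by rewrite mul1r => /eqP; rewrite subr_eq0 => /eqP ->.
  by rewrite leNgt; apply: contra xA => xA; rewrite inE.
exists (clip C \o g); split.
- exact: (mble_comp (measurable_clip _)).
- by move=> x; exact: clip_le.
move=> A GA; rewrite fg//; apply: Ex_ae.
- apply: measurable_funM; first by apply: measurable_indic; exact: sG.2.
  exact: integ_meas Ig.
- apply: measurable_funM; first by apply: measurable_indic; exact: sG.2.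
  by apply: (measurableT_comp (measurable_clip _)); exact: integ_meas Ig.
have := half 1 (normr1 _); have := half (-1) (normrN1 _).
apply: filterS2 => x /=; rewrite mulN1r mul1r => a b.
by rewrite clip_id// ler_norml b andbT lerNl.
Qed.

End sub_sigma_algebras.

(** * Conditional independence *)

Section pi_systems.
Context d (T : measurableType d) (R : realType) (P : probability T R).

Lemma indicI (A B : set T) x : \1_(A `&` B) x = \1_A x * \1_B x :> R.
Proof. by rewrite !indicE in_setI; case: (_ \in _); rewrite ?mul1r ?mul0r. Qed.

(** A form of the pi-lambda theorem: the indicators of [Q] are stable under
    products, so by [bclos_sigma] the indicators of the generated sets are
    bounded limits of their combinations. *)
Lemma Ex_pi_system (Q : set (set T)) (f g : T -> R) : Q setT -> setI_closed Q ->
  Q `<=` measurable -> integ P f -> integ P g ->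
  (forall A, Q A -> Ex P (fun x => \1_A x * f x) = Ex P (fun x => \1_A x * g x)) ->
  forall A, <<s Q >> A -> Ex P (fun x => \1_A x * f x) = Ex P (fun x => \1_A x * g x).
Proof.
move=> QT QI Qm If Ig fg.
have M1 : indics Q (fun=> 1 : R) by exists setT => //; rewrite indicT.
have Mb h : indics Q h -> exists C : R, forall x, `|h x| <= C.
  by move=> [A QA ->]; case: (@bmeas_indic _ T R A) => //; exact: Qm.
have MM h k : indics Q h -> indics Q k -> bclos (indics Q) (fun x => h x * k x : R).
  move=> [A QA ->] [B QB ->]; apply: bclos_gen; exists (A `&` B); first exact: QI.
  by apply/funext => x; rewrite indicI.
have QB : <<s Q >> `<=` [set A | bclos (indics Q) (\1_A : T -> R)].
  apply: smallest_sub; first exact: bclos_sigma.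
  by move=> A QA; apply: bclos_gen; exists A.
move=> A /QB /= MA.
have [] // := @bclos_Ex _ _ _ P (indics Q) f g If Ig _ _ MA.
by move=> _ [B QB' ->]; split; [apply: bmeas_indic; exact: Qm|exact: fg].
Qed.

End pi_systems.

Section cond_indep_theory.
Context d (T : measurableType d) (R : realType) (P : probability T R).
Implicit Types (D G F : set (set T)) (f g h : T -> R).

(** For [D] included in [G]: the conditional expectation of [f] given [G] has a
    [D]-measurable version, that is, [f] is conditionally independent (in mean)
    of [G] given [D]. *)
Definition ci D G f := exists g, [/\ mble D g, integ P g &
  forall A, G A -> Ex P (fun x => \1_A x * f x) = Ex P (fun x => \1_A x * g x)].

Lemma ci_mono D D' G G' f : D `<=` D' -> G' `<=` G -> ci D G f -> ci D' G' f.
Proof.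
move=> DD GG [g [Dg Ig fg]]; exists g; split => //; first exact: mble_sub Dg.
by move=> A /GG; exact: fg.
Qed.

Lemma is_cond_expP G f g : sub_sigma G ->
  is_cond_exp P G f g <-> [/\ integ P f, integ P g, mble G g &
    forall A, G A -> Ex P (fun x => \1_A x * f x) = Ex P (fun x => \1_A x * g x)].
Proof.
move=> sG; split=> -[If Ig Gg fg]; split => //.
- by move=> B mB; apply: Gg; exists B => //; rewrite setTI.
- move=> A GA; apply: EFin_inj; rewrite -!integral_Ex//; [exact: fg|exact: sG.2..].
- by move=> _ [B mB <-]; rewrite setTI; exact: Gg.
- by move=> A GA; rewrite !integral_Ex//; [rewrite fg|exact: sG.2..].
Qed.

Lemma cond_indep_sym F1 F2 F3 : cond_indep P F1 F2 F3 -> cond_indep P F2 F1 F3.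
Proof.
move=> H A B FA FB; have [p [q [r [hp hq hr pq]]]] := H B A FB FA.
exists q, p, r; split => //; first by rewrite setIC.
by apply: filterS pq => x ->; rewrite mulrC.
Qed.

Lemma setU_measurable F1 F2 : F1 `<=` measurable -> F2 `<=` measurable ->
  F1 `|` F2 `<=` (measurable : set (set T)).
Proof. by move=> ? ? A [] ?; auto. Qed.

Lemma sub_sigma_join F1 F2 : F1 `<=` measurable -> F2 `<=` measurable ->
  sub_sigma (join_sigma F1 F2).
Proof. by move=> ? ?; apply: sub_sigma_gen_sub; exact: setU_measurable. Qed.

(** The usual intersection-stable generator of a join of two sigma-algebras. *)
Definition meets F1 F2 : set (set T) :=
  [set A | exists B C, [/\ F1 B, F2 C & A = B `&` C]].

Lemma meetsT F1 F2 : sub_sigma F1 -> sub_sigma F2 -> meets F1 F2 setT.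
Proof. by move=> s1 s2; exists setT, setT; split; [exact: sub_sigmaT|exact: sub_sigmaT|rewrite setIT]. Qed.

Lemma meetsI F1 F2 : sub_sigma F1 -> sub_sigma F2 -> setI_closed (meets F1 F2).
Proof.
move=> s1 s2 _ _ [B [C [FB FC ->]]] [B' [C' [FB' FC' ->]]].
by exists (B `&` B'), (C `&` C'); split; [exact: sub_sigmaI|exact: sub_sigmaI|rewrite setIACA].
Qed.

Lemma meets_measurable F1 F2 : sub_sigma F1 -> sub_sigma F2 -> meets F1 F2 `<=` measurable.
Proof.
move=> s1 s2 _ [B [C [FB FC ->]]].
by apply: measurableI; [exact: s1.2|exact: s2.2].
Qed.

Lemma join_meets F1 F2 : sub_sigma F1 -> sub_sigma F2 -> join_sigma F1 F2 `<=` <<s meets F1 F2 >>.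
Proof.
move=> s1 s2; apply: smallest_sub; first exact: smallest_sigma_algebra.
move=> A [FA|FA]; apply: sub_sigma_algebra.
- by exists A, setT; split => //; [exact: sub_sigmaT|rewrite setIT].
- by exists setT, A; split => //; [exact: sub_sigmaT|rewrite setTI].
Qed.

(** A version of P(A | D), bounded so that it can be multiplied with integrable
    functions. *)
Definition cprob D (A : set T) a := [/\ mble D a, bmeas a &
  forall C, D C -> Ex P (fun x => \1_C x * \1_A x) = Ex P (fun x => \1_C x * a x)].

Lemma cprob_ex D A : sub_sigma D -> measurable A -> exists a, cprob D A a.
Proof.
move=> sD mA; have [||g [? g1 ?]] := @cond_exp_exists_bounded _ _ _ P D (\1_A) 1 sD.
- exact: measurable_indic.
- by move=> x; rewrite indicE; case: (_ \in _); rewrite /= ?normr1 ?normr0.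
by exists g; split => //; split; [exact: mble_meas sD _|exists 1].
Qed.

(** Conditioning on [F3] alone or on the join of [F2] and [F3] gives the same
    probability of [E]: on a set B n C of the generator, with B in [F2] and C in
    [F3], the product formula gives E[1_C P(E | F3) P(B | F3)] = E[1_C P(E | F3)
    1_B]. *)
Lemma cond_indep_ci F1 F2 F3 : sub_sigma F1 -> sub_sigma F2 -> sub_sigma F3 ->
  cond_indep P F1 F2 F3 ->
  forall E, F1 E -> ci F3 (join_sigma F2 F3) (\1_E).
Proof.
move=> s1 s2 s3 H E FE; have mE : measurable E by exact: s1.2.
have bE := @bmeas_indic _ T R E mE.
have [p0 [Gp0 bp0 Ep0]] := cprob_ex s3 mE.
exists p0; split => //; first exact: bmeas_integ.
move=> A /(join_meets s2 s3); move: A.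
apply: Ex_pi_system; [exact: meetsT|exact: meetsI|exact: meets_measurable|exact: bmeas_integ|exact: bmeas_integ|].
move=> _ [B [C [FB FC ->]]].
have mB : measurable B by exact: s2.2.
have mC : measurable C by exact: s3.2.
have bB := @bmeas_indic _ T R B mB; have bC := @bmeas_indic _ T R C mC.
have [p [q [r [/(is_cond_expP _ _ s3)[_ Ip Gp Ep] /(is_cond_expP _ _ s3)[_ Iq Gq Eq]
  /(is_cond_expP _ _ s3)[_ Ir Gr Er] rpq]]]] := H E B FE FB.
(* The definition provides some version of P(E | F3), depending on B; the fixed
   bounded one is almost surely equal to it. *)
have pp0 : {ae P, forall x, p x = p0 x}.
  apply: (cond_exp_unique s3) => //; first exact: bmeas_integ.
  by move=> A FA; rewrite -Ep// Ep0.
transitivity (Ex P (fun x => \1_C x * \1_(E `&` B) x)).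
  by apply: Ex_ext => x; rewrite !indicI; ring.
rewrite Er//; transitivity (Ex P (fun x => \1_C x * p0 x * q x)).
  apply: Ex_ae.
  - by apply: measurable_funM; [exact: bC.1|exact: integ_meas Ir].
  - by apply: measurable_funM; [apply: measurable_funM; [exact: bC.1|exact: bp0.1]|exact: integ_meas Iq].
  by apply: filterS2 rpq pp0 => x -> ->; rewrite mulrA.
rewrite -(@pull_out_bounded _ _ _ P F3 (\1_B) q (fun x => \1_C x * p0 x))//.
- by apply: Ex_ext => x; rewrite indicI; ring.
- exact: bmeas_integ.
- by apply: mbleM => //; exact: mble_indic.
- by case: (bmeasM bC bp0).
Qed.

Lemma ci_cond_indep F1 F2 F3 : sub_sigma F1 -> sub_sigma F2 -> sub_sigma F3 ->
  (forall E, F1 E -> ci F3 (join_sigma F2 F3) (\1_E)) -> cond_indep P F1 F2 F3.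
Proof.
move=> s1 s2 s3 H E B FE FB.
have mE : measurable E by exact: s1.2.
have mB : measurable B by exact: s2.2.
have [p [Gp bp Ep]] := cprob_ex s3 mE; have [q [Gq bq Eq]] := cprob_ex s3 mB.
have [r [Gr br Er]] := cprob_ex s3 (measurableI _ _ mE mB).
have cp A g : measurable A -> cprob F3 A g -> is_cond_prob P F3 A g.
  move=> mA [Gg bg Eg]; apply/is_cond_expP => //; split => //.
    by apply: bmeas_integ; exact: bmeas_indic.
  exact: bmeas_integ.
exists p, q, r; split; [exact: cp|exact: cp|apply: cp => //; exact: measurableI|].
apply: (cond_exp_unique s3) => //.
- exact: mbleM.
- exact: bmeas_integ.
- by apply: bmeas_integ; exact: bmeasM.
move=> C FC; rewrite -Er//.
have bC : bmeas (\1_C : T -> R) by apply: bmeas_indic; exact: s3.2.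
have [g [Gg Ig Eg]] := H E FE.
have J2 : F2 `<=` join_sigma F2 F3 by move=> A FA; apply: sub_sigma_algebra; left.
have J3 : F3 `<=` join_sigma F2 F3 by move=> A FA; apply: sub_sigma_algebra; right.
have gp : {ae P, forall x, g x = p x}.
  apply: (cond_exp_unique s3) => //; first exact: bmeas_integ.
  by move=> A FA; rewrite -Ep// Eg//; exact: J3.
have sJ : sub_sigma (join_sigma F2 F3) by apply: sub_sigma_join; [exact: s2.2|exact: s3.2].
transitivity (Ex P (fun x => \1_(C `&` B) x * \1_E x)).
  by apply: Ex_ext => x; rewrite !indicI; ring.
rewrite Eg; last by apply: (sub_sigmaI sJ); [exact: J3|exact: J2].
have mCB : measurable (C `&` B) by apply: measurableI => //; exact: s3.2.
transitivity (Ex P (fun x => (\1_C x * p x) * \1_B x)).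
  apply: Ex_ae.
  - by apply: measurable_funM; [exact: measurable_indic|exact: integ_meas Ig].
  - by case: (bmeasM (bmeasM bC bp) (@bmeas_indic _ T R B mB)).
  by apply: filterS gp => x ->; rewrite indicI; ring.
rewrite (@pull_out_bounded _ _ _ P F3 (\1_B) q (fun x => \1_C x * p x))//.
- by apply: Ex_ext => x; ring.
- by apply: bmeas_integ; exact: bmeas_indic.
- exact: bmeas_integ.
- by apply: mbleM => //; exact: mble_indic.
- by case: (bmeasM bC bp).
Qed.

(** Self-adjointness of conditional expectations: E[f 1_A] = E[E[f | D] 1_A] =
    E[E[f | D] P(A | D)] = E[f P(A | D)]. With its converse [dual_ci] it
    describes [ci] by identities that are linear in [f], which is what monotone
    class arguments in [f] need. *)
Lemma ci_dual D G f A a : sub_sigma D -> sub_sigma G -> D `<=` G -> integ P f -> ci D G f ->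
  G A -> cprob D A a -> Ex P (fun x => f x * \1_A x) = Ex P (fun x => f x * a x).
Proof.
move=> sD sG DG If [g [Dg Ig fg]] GA [Da ba Ea].
transitivity (Ex P (fun x => \1_A x * f x)).
  by apply: Ex_ext => x; rewrite mulrC.
rewrite fg//; transitivity (Ex P (fun x => a x * g x)); last first.
  rewrite -(@pull_out_bounded _ _ _ P D f g a)//; last first.
  - by move=> C DC; apply: fg; exact: DG.
  - by case: ba.
  by apply: Ex_ext => x; rewrite mulrC.
transitivity (Ex P (fun x => g x * \1_A x)).
  by apply: Ex_ext => x; rewrite mulrC.
rewrite (@pull_out_integrable _ _ _ P D (\1_A) a g)//.
- by apply: Ex_ext => x; rewrite mulrC.
- by apply: bmeas_indic; exact: sG.2.
Qed.

Lemma dual_ci D G f : sub_sigma D -> sub_sigma G -> integ P f ->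
  (forall A a, G A -> cprob D A a ->
    Ex P (fun x => f x * \1_A x) = Ex P (fun x => f x * a x)) -> ci D G f.
Proof.
move=> sD sG If H; have [g [Dg Ig fg]] := cond_exp_exists sD If.
exists g; split => // A GA; have mA : measurable A by exact: sG.2.
have [a [Da ba Ea]] := cprob_ex sD mA.
transitivity (Ex P (fun x => f x * \1_A x)).
  by apply: Ex_ext => x; rewrite mulrC.
rewrite (H A a)//; transitivity (Ex P (fun x => a x * f x)).
  by apply: Ex_ext => x; rewrite mulrC.
rewrite (@pull_out_bounded _ _ _ P D f g a)//; last by case: ba.
transitivity (Ex P (fun x => g x * a x)).
  by apply: Ex_ext => x; rewrite mulrC.
rewrite -(@pull_out_integrable _ _ _ P D (\1_A) a g)//.
- by apply: Ex_ext => x; rewrite mulrC.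
- exact: bmeas_indic.
Qed.

(** Extension from a pi-system to its generated sigma-algebra, through the
    linear description of [ci]. *)
Lemma ci_pi D G Q : sub_sigma D -> sub_sigma G -> D `<=` G -> Q setT -> setI_closed Q ->
  Q `<=` measurable -> (forall E, Q E -> ci D G (\1_E)) ->
  forall E, <<s Q >> E -> ci D G (\1_E).
Proof.
move=> sD sG DG QT QI Qm H E QE.
have mE : measurable E by exact: (sub_sigma_gen_sub Qm).2.
apply: dual_ci => //; first by apply: bmeas_integ; exact: bmeas_indic.
move=> A a GA Aa; move: E QE {mE}; have mA : measurable A by exact: sG.2.
apply: Ex_pi_system => //.
- by apply: bmeas_integ; exact: bmeas_indic.
- by case: Aa => _ /bmeas_integ.
move=> E QE; apply: (ci_dual sD sG DG) => //; last exact: H.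
by apply: bmeas_integ; apply: bmeas_indic; exact: Qm.
Qed.

(** Extension from the events of [S] to its integrable functions, through the
    linear description of [ci]. *)
Lemma ci_integ D G S f : sub_sigma D -> sub_sigma G -> sub_sigma S -> D `<=` G ->
  (forall E, S E -> ci D G (\1_E)) -> mble S f -> integ P f -> ci D G f.
Proof.
move=> sD sG sS DG H Sf If; apply: dual_ci => // A a GA Aa.
have mA : measurable A by exact: sG.2.
apply: (@pull_out_integrable _ _ _ P S) => //.
- exact: bmeas_indic.
- by case: Aa.
move=> E SE; apply: (ci_dual sD sG DG) => //; last exact: H.
by apply: bmeas_integ; apply: bmeas_indic; exact: sS.2.
Qed.

Lemma ci_ae D G f f' : sub_sigma G -> integ P f -> measurable_fun setT f' ->
  {ae P, forall x, f x = f' x} -> ci D G f -> ci D G f'.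
Proof.
move=> sG If mf' ff' [g [Dg Ig fg]]; exists g; split => // A GA; rewrite -fg//.
have mA : measurable_fun setT (\1_A : T -> R) by apply: measurable_indic; exact: sG.2.
apply: Ex_ae.
- exact: measurable_funM.
- by apply: measurable_funM => //; exact: integ_meas If.
- by apply: filterS ff' => x ->.
Qed.

Lemma sub_sigma_compl H : H `<=` measurable -> sub_sigma (sigma_completion P H).
Proof. by move=> mH; apply: sub_sigma_gen_sub => A [/mH//|[]]. Qed.

Lemma sub_compl H : H `<=` sigma_completion P H.
Proof. by move=> A HA; apply: sub_sigma_algebra; left. Qed.

(** The sets that agree almost surely with a member of [H] form a sigma-algebra. *)
Lemma compl_char H A : sub_sigma H -> sigma_completion P H A ->
  exists2 B, H B & {ae P, forall x, \1_A x = \1_B x :> R}.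
Proof.
move=> sH; move: A; apply: smallest_sub; last first.
  move=> A [HA|[mA PA]]; first by exists A => //; exact: aeW.
  exists set0; first by case: sH.1.
  exists A; split => // x /= h; apply: contrapT => nA; apply: h.
  by rewrite !indicE in_set0 memNset.
split.
- by exists set0; [case: sH.1|exact: aeW].
- move=> A [B HB AB]; exists (~` B); first exact: sub_sigmaC.
  by apply: filterS AB => x; rewrite setTD !indicE !in_setC;
    case: (_ \in _); case: (_ \in _) => //= /eqP; rewrite ?oner_eq0 // eq_sym oner_eq0.
- move=> A AH; pose B n := s2val (cid2 (AH n)).
  have HB n : H (B n) by exact: (s2valP (cid2 (AH n))).
  have AB n : {ae P, forall x, \1_(A n) x = \1_(B n) x :> R}.
    exact: (s2valP' (cid2 (AH n))).
  exists (\bigcup_k B k); first by case: sH.1 => _ _; exact.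
  apply: filterS (ae_foralln AB) => x ABx; rewrite !indicE; congr (nat_of_bool _)%:R.
  have h k : (x \in A k) = (x \in B k).
    have := ABx k; rewrite !indicE.
    by case: (_ \in _); case: (_ \in _) => //= /eqP; rewrite ?oner_eq0 // eq_sym oner_eq0.
  apply/idP/idP => /set_mem[k _ /mem_set].
    by rewrite h => /set_mem xk; apply/mem_set; exists k.
  by rewrite -h => /set_mem xk; apply/mem_set; exists k.
Qed.

(** A set of the completion differs from a set of [H] by a null set, so E[g | H]
    is also the conditional expectation of [g] given the completion, which is
    [g] itself. *)
Lemma ci_compl H G f : sub_sigma H -> sub_sigma G -> H `<=` G -> ci (sigma_completion P H) G f -> ci H G f.
Proof.
move=> sH sG HG [g [Hg Ig fg]]; have sC := sub_sigma_compl sH.2.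
have [g' [Hg' Ig' gg']] := cond_exp_exists sH Ig.
have e : {ae P, forall x, g x = g' x}.
  apply: (cond_exp_unique sC) => //; first exact: mble_sub (@sub_compl H) Hg'.
  move=> A CA; have [B HB AB] := compl_char sH CA.
  have mA : measurable A by exact: sC.2.
  have mB : measurable B by exact: sH.2.
  have E k : integ P k -> Ex P (fun x => \1_A x * k x) = Ex P (fun x => \1_B x * k x).
    move=> Ik; apply: Ex_ae.
    - by apply: measurable_funM; [exact: measurable_indic|exact: integ_meas Ik].
    - by apply: measurable_funM; [exact: measurable_indic|exact: integ_meas Ik].
    - by apply: filterS AB => x ->.
  by rewrite !E// gg'.
exists g'; split => // A GA; rewrite fg//.
have mA : measurable_fun setT (\1_A : T -> R) by apply: measurable_indic; exact: sG.2.
apply: Ex_ae.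
- by apply: measurable_funM => //; exact: integ_meas Ig.
- by apply: measurable_funM => //; exact: integ_meas Ig'.
- by apply: filterS e => x ->.
Qed.

Lemma mble_compl H g g' : H `<=` measurable -> mble H g -> measurable_fun setT g' ->
  {ae P, forall x, g x = g' x} -> mble (sigma_completion P H) g'.
Proof.
move=> mH Hg mg' [N [mN PN gg']] B mB.
have sC := sub_sigma_compl mH.
have HN : sigma_completion P H N by apply: sub_sigma_algebra; right.
have mgB : measurable (g' @^-1` B) by rewrite -[X in measurable X]setTI; exact: mg'.
have -> : g' @^-1` B = (g @^-1` B `&` ~` N) `|` (g' @^-1` B `&` N).
  have e x : ~ N x -> g x = g' x by move=> xN; apply: contrapT => h; exact/xN/gg'.
  apply/seteqP; split => x /=.
    by move=> Bx; have [xN|xN] := pselect (N x); [right|left; split => //; rewrite /= e].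
  by move=> [[Bx xN]|[]//]; rewrite /= -e.
have sU X Y : sigma_completion P H X -> sigma_completion P H Y ->
    sigma_completion P H (X `|` Y).
  move=> hX hY; rewrite -(setCK (X `|` Y)) setCU.
  by apply: (sub_sigmaC sC); apply: (sub_sigmaI sC); exact: (sub_sigmaC sC).
apply: sU; first by apply: (sub_sigmaI sC); [by apply: sub_compl; exact: Hg|exact: (sub_sigmaC sC)].
apply: sub_sigma_algebra; right; split; first exact: measurableI.
by apply: (subset_measure0 _ mN _ PN); [exact: measurableI|exact: subIsetr].
Qed.

(** Intersection property. The versions g1 and g2 both represent E[f | G], so
    they agree almost surely and g1 is measurable for the completions of both
    [D1] and [D2], hence for that of [D]. *)
Lemma ci_intersection D1 D2 D G f : sub_sigma D1 -> sub_sigma D2 -> sub_sigma D -> sub_sigma G ->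
  D1 `<=` G -> D2 `<=` G -> D `<=` G ->
  sigma_completion P D1 `&` sigma_completion P D2 `<=` sigma_completion P D ->
  ci D1 G f -> ci D2 G f -> ci D G f.
Proof.
move=> s1 s2 sD sG D1G D2G DG sub [g1 [Hg1 Ig1 fg1]] [g2 [Hg2 Ig2 fg2]].
apply: ci_compl => //; exists g1; split => //.
have e : {ae P, forall x, g2 x = g1 x}.
  apply: (cond_exp_unique sG) => //; [exact: mble_sub Hg2|exact: mble_sub Hg1|].
  by move=> A GA; rewrite -fg2// -fg1.
move=> B mB; apply: sub; split; first by apply: sub_compl; exact: Hg1.
by apply: (mble_compl s2.2 Hg2) => //; exact: integ_meas Ig1.
Qed.

End cond_indep_theory.

(** * Granger noncausality and composition *)

Lemma ae_forall_fin d (T : measurableType d) (R : realType) (P : probability T R)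
    (V : finType) (Q : V -> T -> Prop) :
  (forall v, {ae P, forall x, Q v x}) -> {ae P, forall x, forall v, Q v x}.
Proof.
move=> aeQ.
have : {ae P, forall x, forall n, forall v : V, (enum_rank v : nat) = n -> Q v x}.
  apply: ae_foralln => n.
  have [[v <-]|nv] := pselect (exists v : V, (enum_rank v : nat) = n).
    by apply: filterS (aeQ v) => x Qx u /ord_inj/enum_rank_inj ->.
  by apply: aeW => x u un; exfalso; apply: nv; exists u.
by apply: filterS => x Qx v; exact: (Qx _ v erefl).
Qed.

Section process.
Context d (T : measurableType d) (R : realType) (P : probability T R) (V : finType)
  (X : V -> int -> {RV P >-> R}).
Implicit Types (A B C D S U : {set V}) (t : int).
Local Notation ci := (ci P).

Lemma past_gen A t v s (B : set R) : v \in A -> s <= t -> measurable B ->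
  past X A t (X v s @^-1` B).
Proof.
move=> vA st mB; apply: sub_sigma_algebra; exists (v, s) => //.
by exists B => //; rewrite setTI.
Qed.

Lemma past_sub A t (G : set (set T)) : sub_sigma G ->
  (forall v s, v \in A -> s <= t -> mble G (X v s : T -> R)) -> past X A t `<=` G.
Proof.
move=> sG H; apply: smallest_sub; first exact: sG.1.
move=> _ [[v s] /= [vA st] [B mB <-]]; rewrite setTI; exact: H.
Qed.

Lemma past_sub_sigma A t : sub_sigma (past X A t).
Proof.
apply: sub_sigma_gen_sub => _ [[v s] /= _ [B mB <-]].
by rewrite setTI; exact: measurable_funPTI.
Qed.

Lemma past_mono A B t t' : A \subset B -> t <= t' -> past X A t `<=` past X B t'.
Proof.
move=> AB tt; apply: past_sub; first exact: past_sub_sigma.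
by move=> v s vA st C mC; apply: past_gen => //; [exact: (fintype.subsetP AB)|exact: le_trans tt].
Qed.

Lemma join_sub_sigma (F1 F2 G : set (set T)) : sub_sigma G -> F1 `<=` G -> F2 `<=` G ->
  join_sigma F1 F2 `<=` G.
Proof. by move=> sG h1 h2; apply: smallest_sub; [exact: sG.1|move=> A []; auto]. Qed.

Lemma join_l (F1 F2 : set (set T)) : F1 `<=` join_sigma F1 F2.
Proof. by move=> A FA; apply: sub_sigma_algebra; left. Qed.

Lemma join_r (F1 F2 : set (set T)) : F2 `<=` join_sigma F1 F2.
Proof. by move=> A FA; apply: sub_sigma_algebra; right. Qed.

(** The conditioning sigma-algebra of contemporaneous noncausality. *)
Definition past_next t A := join_sigma (past X [set: V]%SET t) (past X A (t + 1)).

Lemma past_next_sub_sigma t A : sub_sigma (past_next t A).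
Proof. by apply: sub_sigma_join; exact: (past_sub_sigma _ _).2. Qed.

Lemma past_next_mono t A B : A \subset B -> past_next t A `<=` past_next t B.
Proof.
move=> AB; apply: join_sub_sigma; first exact: past_next_sub_sigma.
- exact: join_l.
- by apply: subset_trans (@join_r _ _); exact: past_mono.
Qed.

Lemma past_join A B t : join_sigma (past X A t) (past X B t) = past X (A :|: B)%SET t.
Proof.
apply/seteqP; split.
  apply: join_sub_sigma; [exact: past_sub_sigma|apply: past_mono => //; exact: finset.subsetUl|].
  by apply: past_mono => //; exact: finset.subsetUr.
apply: past_sub; first by apply: sub_sigma_join; exact: (past_sub_sigma _ _).2.
move=> v s; rewrite finset.in_setU => /orP[vA|vB] st C mC.
- by apply: join_l; exact: past_gen.
- by apply: join_r; exact: past_gen.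
Qed.

Lemma past_next_join A B t : join_sigma (past X A (t + 1)) (past_next t B) = past_next t (A :|: B)%SET.
Proof.
apply/seteqP; split.
  apply: join_sub_sigma; first exact: past_next_sub_sigma.
  - by apply: subset_trans (@join_r _ _); apply: past_mono => //; exact: finset.subsetUl.
  - by apply: past_next_mono; exact: finset.subsetUr.
have sJ : sub_sigma (join_sigma (past X A (t + 1)) (past_next t B)).
  by apply: sub_sigma_join; [exact: (past_sub_sigma _ _).2|exact: (past_next_sub_sigma _ _).2].
apply: join_sub_sigma => //.
  exact: subset_trans (@join_l _ _) (@join_r _ _).
rewrite -past_join; apply: join_sub_sigma => //; first exact: join_l.
exact: subset_trans (@join_r _ _) (@join_r _ _).
Qed.

Lemma integ_indic (A : set T) : measurable A -> integ P (\1_A : T -> R).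
Proof. by move=> mA; apply: bmeas_integ; exact: bmeas_indic. Qed.

Lemma granger_ci A B : granger_noncausal X A B <->
  forall t E, past X B (t + 1) E ->
    ci (past X (~: A)%SET t) (past X [set: V]%SET t) (\1_E).
Proof.
rewrite -(finset.setUCr A); split=> H t.
  move=> E FE; rewrite -past_join.
  by apply: cond_indep_ci (H t) _ FE; exact: past_sub_sigma.
apply: ci_cond_indep; [exact: past_sub_sigma..|].
by move=> E FE; rewrite past_join; exact: H.
Qed.

Lemma contemp_sym A B : contemp_noncausal X A B -> contemp_noncausal X B A.
Proof. by move=> H t; apply: cond_indep_sym; rewrite finset.setUC; exact: H. Qed.

Lemma contemp_ci A B : A \subset (~: B)%SET -> contemp_noncausal X A B <->
  forall t E, past X A (t + 1) E ->
    ci (past_next t (~: (A :|: B))%SET) (past_next t (~: A)%SET) (\1_E).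
Proof.
move=> AB; have e : (~: A = B :|: ~: (A :|: B))%SET.
  apply/setP => v; rewrite !inE; have := fintype.subsetP AB v; rewrite inE.
  by case: (v \in A); case: (v \in B) => // /(_ isT).
split=> H t.
  move=> E FE; rewrite e -past_next_join.
  by apply: cond_indep_ci (H t) _ FE; [exact: past_sub_sigma|exact: past_sub_sigma|exact: past_next_sub_sigma].
apply: ci_cond_indep; [exact: past_sub_sigma|exact: past_sub_sigma|exact: past_next_sub_sigma|].
by move=> E FE; rewrite past_next_join -e; exact: H.
Qed.

(** In the formulation of [contemp_ci] for the pair (B, A), decreasing [A]
    enlarges the sigma-algebra for which the conditional probability should be
    measurable. *)
Lemma contemp_mono A A' B : A \subset (~: B)%SET -> A' \subset A ->
  contemp_noncausal X A B -> contemp_noncausal X A' B.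
Proof.
move=> AB sA /contemp_sym H; apply: contemp_sym.
have BA : B \subset (~: A)%SET by rewrite finset.subsetC.
apply/contemp_ci; first by rewrite (fintype.subset_trans BA)// finset.setCS.
move=> t E FE; have := (contemp_ci BA).1 H t E FE.
by apply: ci_mono => //; apply: past_next_mono; rewrite finset.setCS finset.setUS.
Qed.

(** Iterated intersection property for an increasing family of sigma-algebras
    indexed by sets of vertices: if each single vertex of [S] can be removed
    from [U], all can be removed at once. It is used for the pasts at time t and
    for [past_next t]. *)
Lemma ci_setD (Psi : {set V} -> set (set T)) (G : set (set T)) U S f :
  (forall A, sub_sigma (Psi A)) -> (forall A B, A \subset B -> Psi A `<=` Psi B) ->
  (forall A B, sigma_completion P (Psi A) `&` sigma_completion P (Psi B) `<=`
     sigma_completion P (Psi (A :&: B)%SET)) ->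
  sub_sigma G -> Psi U `<=` G -> ci (Psi U) G f ->
  (forall a, a \in S -> ci (Psi (U :\ a)%SET) G f) -> ci (Psi (U :\: S)%SET) G f.
Proof.
move=> sPsi mPsi sep sG UG cU.
have -> : S = [set x in enum S]%SET by apply/setP => x; rewrite inE mem_enum.
move=> H; have {H} : forall a, a \in enum S -> ci (Psi (U :\ a)%SET) G f.
  by move=> a aS; apply: H; rewrite inE.
elim: (enum S) => [_|a s IH H].
  by rewrite (_ : [set x in [::]]%SET = finset.set0) ?finset.setD0//; apply/setP => x; rewrite !inE.
have -> : (U :\: [set x in a :: s] = (U :\ a) :&: (U :\: [set x in s]))%SET.
  by apply/setP => x; rewrite !inE; case: (x == a); case: (x \in s); case: (x \in U).
have sub A : A \subset U -> Psi A `<=` G by move=> AU; apply: subset_trans (mPsi _ _ AU) UG.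
apply: (@ci_intersection _ _ _ _ (Psi (U :\ a)%SET) (Psi (U :\: [set x in s])%SET)) => //.
- by apply: sub; exact: finset.subsetDl.
- by apply: sub; exact: finset.subsetDl.
- by apply: sub; apply: fintype.subset_trans (finset.subsetIl _ _) _; exact: finset.subsetDl.
- by apply: H; rewrite inE eqxx.
- by apply: IH => b bs; apply: H; rewrite inE bs orbT.
Qed.

Section separation.
Hypothesis hsep : forall A B C (k : nat) t, (0 < k)%N ->
  measurably_separable P (past X A t) (past X B t)
    (join_sigma (past X (A :&: B)%SET t) (past X C (t - k%:Z))).

Lemma compl_mono (F G : set (set T)) : F `<=` G -> sigma_completion P F `<=` sigma_completion P G.
Proof.
move=> FG; apply: smallest_sub; first exact: smallest_sigma_algebra.
by move=> A [/FG GA|NA]; apply: sub_sigma_algebra; [left|right].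
Qed.

(** Separation given F_(A n B)(t) alone: with C empty, the additional F_C(t-1)
    is contained in every past. *)
Lemma sep_past t A B : sigma_completion P (past X A t) `&` sigma_completion P (past X B t)
  `<=` sigma_completion P (past X (A :&: B)%SET t).
Proof.
move=> E [EA EB].
have := @hsep A B finset.set0 1 t isT; rewrite /measurably_separable => /seteqP[h _].
have /h : (sigma_completion P (join_sigma (past X A t) (join_sigma (past X (A :&: B)%SET t) (past X finset.set0 (t - 1%:Z)))) `&`
   sigma_completion P (join_sigma (past X B t) (join_sigma (past X (A :&: B)%SET t) (past X finset.set0 (t - 1%:Z))))) E.
  by split; [apply: compl_mono EA|apply: compl_mono EB]; exact: join_l.
apply: compl_mono; apply: join_sub_sigma => //; first exact: past_sub_sigma.
by apply: past_mono; [exact: finset.sub0set|rewrite lerBlDr lerDl].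
Qed.

(** Separation at time t + 1 with C = V and k = 1, since t + 1 - 1 = t makes the
    additional sigma-algebra F_V(t). *)
Lemma sep_past_next t A B : sigma_completion P (past_next t A) `&` sigma_completion P (past_next t B)
  `<=` sigma_completion P (past_next t (A :&: B)%SET).
Proof.
move=> E [EA EB].
have := @hsep A B [set: V]%SET 1 (t + 1) isT.
rewrite addrK /measurably_separable => /seteqP[h _].
set J := join_sigma (past X (A :&: B)%SET (t + 1)) (past X [set: V]%SET t) in h.
have sJ : sub_sigma J by apply: sub_sigma_join; exact: (past_sub_sigma _ _).2.
have JJ C : past_next t C `<=` join_sigma (past X C (t + 1)) J.
  apply: join_sub_sigma; first by apply: sub_sigma_join; [exact: (past_sub_sigma _ _).2|exact: sJ.2].
  - exact: subset_trans (@join_r _ _) (@join_r _ _).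
  - exact: join_l.
have /h : (sigma_completion P (join_sigma (past X A (t + 1)) J) `&`
   sigma_completion P (join_sigma (past X B (t + 1)) J)) E.
  by split; [apply: compl_mono EA|apply: compl_mono EB]; exact: JJ.
apply: compl_mono; apply: join_sub_sigma; [exact: past_next_sub_sigma|exact: join_r|exact: join_l].
Qed.

End separation.

(** The composition property of conditional independence, restricted to the
    variables one step ahead of the past on which one conditions. *)
Definition composable := forall t A D, A \subset D ->
  (forall b, b \in A -> forall E, past X [set b]%SET (t + 1) E ->
     ci (past X D t) (past X [set: V]%SET t) (\1_E)) ->
  forall E, past X A (t + 1) E -> ci (past X D t) (past X [set: V]%SET t) (\1_E).

Lemma int_le_succ (s t : int) : s <= t + 1 -> s <= t \/ s = t + 1.
Proof.
rewrite le_eqVlt => /orP[/eqP ->|]; first by right.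
by rewrite ltzD1; left.
Qed.

Lemma X_meas v s : measurable_fun setT (X v s : T -> R).
Proof. exact: measurable_funP. Qed.

(** Events of the noise and of F_D(t) are treated first: on E1 n C the
    conditional probability is P(E1) 1_C by independence. Then X_b(t+1) is
    measurable for the completion of the join of noise and F_D(t), because its
    conditional mean m_b is almost surely equal to the F_D(t)-measurable version
    that the hypothesis on b provides. *)
Lemma past_only_composable : past_only_in_mean X -> composable.
Proof.
move=> H t A D AD Hb.
have [m [Em ind]] := H t; set FV := past X [set: V]%SET t in Em ind *.
have sV : sub_sigma FV by exact: past_sub_sigma.
have sD : sub_sigma (past X D t) by exact: past_sub_sigma.
have DV : past X D t `<=` FV by apply: past_mono => //; exact: finset.subsetT.
pose eps v (w : T) : R := X v (t + 1) w - m v w.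
have meps v : measurable_fun setT (eps v).
  apply: measurable_funB; first exact: X_meas.
  by have [_ Im _ _] := Em v; exact: integ_meas Im.
set Se := sigma_family _ _ in ind.
have sE : sub_sigma Se.
  apply: sub_sigma_gen_sub => _ [v _ [B mB <-]].
  exact: meps.
pose S := join_sigma Se (past X D t).
have sS : sub_sigma S by apply: sub_sigma_join; [exact: sE.2|exact: sD.2].
(* S carries the noise and F_D(t); all its events have F_D(t)-measurable
   conditional probability. *)
have ciS E : S E -> ci (past X D t) FV (\1_E).
  move=> /(join_meets sE sD); move: E.
  apply: ci_pi => //; [exact: meetsT|exact: meetsI|exact: meets_measurable|].
  move=> _ [E1 [C [SE1 FC ->]]].
  have mE1 : measurable E1 by exact: sE.2.
  have mC : measurable C by exact: sD.2.
  exists (fun x => \1_C x * fine (P E1)); split.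
  - by apply: (mbleM sD); [exact: mble_indic|exact: mble_cst].
  - by apply: integM; [exact: bmeas_indic|exact/bmeas_integ/bmeas_cst].
  move=> B FB; have mB : measurable B by exact: sV.2.
  transitivity (Ex P (\1_(E1 `&` (B `&` C)) : T -> R)).
    by apply: Ex_ext => x; rewrite !indicI mulrCA.
  transitivity (Ex P (\1_(B `&` C) : T -> R) * fine (P E1)).
    rewrite !Ex_indic; [|exact: measurableI|by apply: measurableI => //; exact: measurableI].
    rewrite ind//; last by apply: (sub_sigmaI sV) => //; exact: DV.
    rewrite fineM; [exact: mulrC|exact: fin_num_measure|].
    by apply: fin_num_measure; exact: measurableI.
  rewrite -ExZr; last by apply: integ_indic; exact: measurableI.
  by apply: Ex_ext => x; rewrite indicI mulrA.
(* m b agrees only almost surely with an F_D(t)-measurable variable, hence the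
   completion. *)
have mX b : b \in A -> mble (sigma_completion P S) (X b (t + 1) : T -> R).
  move=> bA.
  have [IX Im /= Gm EXm] := (is_cond_expP _ _ _ sV).1 (Em b).
  have [m' [Dm' Im' EXm']] : ci (past X D t) FV (X b (t + 1) : T -> R).
    apply: (@ci_integ _ _ _ _ _ _ (past X [set b]%SET (t + 1))) => //.
    - exact: past_sub_sigma.
    - exact: Hb.
    - by move=> B mB; apply: past_gen => //; rewrite inE.
  have e : {ae P, forall x, m b x = m' x}.
    apply: (cond_exp_unique sV) => //; first exact: mble_sub Dm'.
    by move=> B FB; rewrite -EXm// EXm'.
  apply: (@mble_compl _ _ _ _ _ (fun x => eps b x + m' x)) => //; first exact: sS.2.
  - apply: (mbleD sS); last by apply: mble_sub Dm'; exact: join_r.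
    move=> B mB; apply: join_l; apply: sub_sigma_algebra; exists b => //.
    by exists B => //; rewrite setTI.
  - by apply: filterS e => x <-; rewrite /eps subrK.
move=> E FE.
have sC : sub_sigma (sigma_completion P S) by apply: sub_sigma_compl; exact: sS.2.
have : sigma_completion P S E.
  apply: (past_sub sC) FE => v s vA /int_le_succ[st|->]; last exact: mX.
  move=> B mB; apply: sub_compl; apply: join_r; apply: past_gen => //.
  exact: (fintype.subsetP AD).
move=> /(compl_char sS)[E' SE' EE'].
have mE : measurable E by exact: (past_sub_sigma A (t + 1)).2.
have mE' : measurable E' by exact: sS.2.
apply: (@ci_ae _ _ _ _ _ _ (\1_E')) => //.
- exact: integ_indic.
- by apply: filterS EE' => x ->.
- exact: ciS.
Qed.

Lemma ci_cprob (D G : set (set T)) E a : sub_sigma D -> sub_sigma G -> D `<=` G -> measurable E ->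
  ci D G (\1_E) -> cprob P D E a ->
  forall Z, G Z -> Ex P (fun x => \1_Z x * \1_E x) = Ex P (fun x => \1_Z x * a x).
Proof.
move=> sD sG DG mE [g [Dg Ig Eg]] [Da ba Ea] A GA.
have e : {ae P, forall x, g x = a x}.
  apply: (cond_exp_unique sD) => //; first exact: bmeas_integ.
  by move=> B DB; rewrite -Ea// Eg//; exact: DG.
have mA : measurable_fun setT (\1_A : T -> R) by apply: measurable_indic; exact: sG.2.
rewrite Eg//; apply: Ex_ae.
- by apply: measurable_funM => //; exact: integ_meas Ig.
- by apply: measurable_funM => //; case: ba.
- by apply: filterS e => x ->.
Qed.

Lemma measurable_box (B : V -> set R) : (forall v, measurable (B v)) ->
  measurable ([set x | forall v, B v (x v)] : set (Rprod R V)).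
Proof.
move=> mB; have -> : [set x : Rprod R V | forall v, B v (x v)] =
    \bigcap_(v in [set: V]) ((fun x : Rprod R V => x v) @^-1` B v).
  by apply/seteqP; split => [x Bx v _|x Bx v]; [exact: Bx|exact: Bx v Logic.I].
apply: fin_bigcap_measurable; first exact: finite_finset.
move=> v _; apply: sub_sigma_algebra; exists v => //.
by exists (B v) => //; rewrite setTI.
Qed.

(** For a box in the variables X_v(t+1), v in [A], intersected with C in F_D(t),
    the conditional probability given F_V(t) is 1_C times the product of those
    of the sides, and each factor has an F_D(t)-measurable version. These sets
    form a pi-system generating F_A(t+1) and F_D(t). *)
Lemma contemp_indep_composable : contemporaneously_independent X -> composable.
Proof.
move=> H t A D AD Hb.
have [K [k [HK Hk Kk]]] := H t; set FV := past X [set: V]%SET t in HK Hk *.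
have sV : sub_sigma FV by exact: past_sub_sigma.
have sD : sub_sigma (past X D t) by exact: past_sub_sigma.
have DV : past X D t `<=` FV by apply: past_mono => //; exact: finset.subsetT.
pose box (B : V -> set R) : set T := [set x | forall v, B v (X v (t + 1) x)].
(* Sides outside A are trivial, so that only the hypotheses on vertices of A
   are used. *)
pose Q : set (set T) := [set E | exists (B : V -> set R) (C : set T),
  [/\ forall v, measurable (B v), forall v, v \notin A -> B v = setT,
      past X D t C & E = box B `&` C]].
have mbox (B : V -> set R) : (forall v, measurable (B v)) -> measurable (box B).
  move=> mB; have -> : box B = \bigcap_(v in [set: V]) (X v (t + 1) @^-1` B v).
    by apply/seteqP; split => [x Bx v _|x Bx v]; [exact: Bx|exact: Bx v Logic.I].
  apply: fin_bigcap_measurable; first exact: finite_finset.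
  by move=> v _; exact: measurable_funPTI.
have Qm : Q `<=` measurable.
  move=> _ [B [C [mB _ DC ->]]]; apply: measurableI; first exact: mbox.
  exact: sD.2.
have QI : setI_closed Q.
  move=> _ _ [B [C [mB BA DC ->]]] [B' [C' [mB' BA' DC' ->]]].
  exists (fun v => B v `&` B' v), (C `&` C'); split.
  - by move=> v; exact: measurableI.
  - by move=> v vA; rewrite BA// BA'// setIT.
  - exact: (sub_sigmaI sD).
  apply/seteqP; split => x /=.
    by move=> [[Bx Cx] [Bx' Cx']]; split => // v; split.
  by move=> [BB [Cx Cx']]; split; split => // v; have [] := BB v.
have QT : Q setT.
  exists (fun=> setT), setT; split => //; first exact: sub_sigmaT.
  by apply/seteqP; split => // x _; split => // v.
suff HQ : forall E, Q E -> ci (past X D t) FV (\1_E).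
  move=> E FE; apply: (ci_pi sD sV DV QT QI Qm HQ).
  apply: (past_sub (sub_sigma_gen_sub Qm) _ FE) => v s vA /int_le_succ[st|->] B mB.
    apply: sub_sigma_algebra; exists (fun=> setT), (X v s @^-1` B); split => //.
      by apply: past_gen => //; exact: (fintype.subsetP AD).
    by apply/seteqP; split => [x Bx|x []//]; split.
  apply: sub_sigma_algebra; exists (fun u => if u == v then B else setT), setT; split => //.
  - by move=> u; case: ifP.
  - by move=> u uA; case: eqP => // uv; rewrite uv vA in uA.
  - exact: sub_sigmaT.
  apply/seteqP; split => [x Bx|x [/(_ v)]].
    by split => // u; case: eqP => [->|].
  by rewrite eqxx.
move=> _ [B [C [mB BA DC ->]]].
have mC : measurable C by exact: sD.2.
have mXB v : measurable (X v (t + 1) @^-1` B v) by exact: measurable_funPTI.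
have [a Ha] : exists a : V -> T -> R, forall v, cprob P (past X D t) (X v (t + 1) @^-1` B v) (a v).
  by exists (fun v => sval (cid (cprob_ex P sD (mXB v)))) => v; exact: svalP.
have kv v : {ae P, forall w, fine (k v w (B v)) = a v w}.
  have [_ Ik Gk Ek] := (is_cond_expP _ _ _ sV).1 (Hk v (B v) (mB v)).
  have [Da ba Ea] := Ha v.
  apply: (cond_exp_unique sV) => //; [exact: mble_sub Da|exact: bmeas_integ|].
  move=> Z FZ; rewrite -Ek//; move: Z FZ; apply: (ci_cprob sD sV DV (mXB v)); last exact: Ha.
  have [vA|vA] := boolP (v \in A).
    by apply: (Hb v vA); apply: past_gen => //; rewrite inE.
  rewrite (BA v vA) preimage_setT; exists (fun=> 1); split.
  - exact: mble_cst.
  - by apply: bmeas_integ; exact: bmeas_cst.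
  - by move=> Z _; apply: Ex_ext => x; rewrite indicT.
have prodD (s : seq V) : mble (past X D t) (fun w => \prod_(v <- s) a v w) /\
    bmeas (fun w => \prod_(v <- s) a v w).
  elim: s => [|v s [IH1 IH2]].
    under eq_fun do rewrite big_nil.
    by split; [exact: mble_cst|exact: bmeas_cst].
  under eq_fun do rewrite big_cons.
  by have [Da ba _] := Ha v; split; [exact: mbleM|exact: bmeasM].
have [Dp bp] := prodD (index_enum V).
exists (fun w => \1_C w * \prod_v a v w); split.
- by apply: (mbleM sD) => //; exact: mble_indic.
- by apply: integM; [exact: bmeas_indic|exact: bmeas_integ].
move=> Z FZ; have mZ : measurable Z by exact: sV.2.
have [_ IK GK EK] := (is_cond_expP _ _ _ sV).1 (HK _ (measurable_box mB)).
transitivity (Ex P (fun x => \1_(Z `&` C) x * \1_(box B) x)).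
  by apply: Ex_ext => x; rewrite !indicI mulrAC mulrA.
have mZC : measurable_fun setT (\1_(Z `&` C) : T -> R).
  by apply: measurable_indic; exact: measurableI.
rewrite -[box B]/((fun w => (fun v => X v (t + 1) w) : Rprod R V) @^-1` [set x | forall v, B v (x v)]).
rewrite EK; last by apply: (sub_sigmaI sV) => //; exact: DV.
transitivity (Ex P (fun x => \1_(Z `&` C) x * \prod_v a v x)).
  apply: Ex_ae.
  - by apply: measurable_funM => //; exact: integ_meas IK.
  - by apply: measurable_funM => //; case: bp.
  have kall := ae_forall_fin kv.
  apply: filterS2 Kk kall => w Kw kw; congr (_ * _).
  rewrite Kw//; under [RHS]eq_bigr do rewrite -kw.
  suff -> : (\prod_v k v w (B v))%E = (\prod_v fine (k v w (B v)))%:E by [].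
  elim: (index_enum V) => [|v s IHs]; first by rewrite !big_nil.
  by rewrite !big_cons EFinM IHs fineK// fin_num_measure.
by apply: Ex_ext => x; rewrite indicI mulrA.
Qed.

Section main.
Variable G : mixed_graph V.
Hypothesis hsep : forall A B C (k : nat) t, (0 < k)%N ->
  measurably_separable P (past X A t) (past X B t)
    (join_sigma (past X (A :&: B)%SET t) (past X C (t - k%:Z))).
Hypothesis comp : composable.

Lemma block_local : block_markov G X -> local_markov G X.
Proof.
move=> H a; have := H [set a]%SET.
have -> : (pa G [set a] :|: [set a] = pa1 G a :|: [set a])%SET.
  by apply/setP => v; rewrite /pa big_set1 !inE; case: (v == a); rewrite /= ?orbT ?orbF.
have -> // : (ne G [set a] :|: [set a] = ne1 G a :|: [set a])%SET.
by apply/setP => v; rewrite /ne big_set1 !inE; case: (v == a); rewrite /= ?orbT ?orbF.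
Qed.

Lemma local_pairwise : local_markov G X -> pairwise_markov G X.
Proof.
move=> H a b ab; have [H1 H2] := H b; split=> e.
  apply/granger_ci => t E FE; have := (granger_ci _ _).1 H1 t E FE.
  apply: ci_mono => //; apply: past_mono => //; rewrite finset.setCK finset.subsetC.
  by rewrite finset.sub1set !inE (negbTE e) (negbTE ab).
apply: contemp_mono H2; first by rewrite finset.setCS finset.subsetUr.
by rewrite finset.sub1set !inE (negbTE e) (negbTE ab).
Qed.

(** Both halves remove the vertices that are not adjacent to [b] one by one,
    from V for the directed half and from the complement of [b] for the
    contemporaneous half. *)
Lemma pairwise_local : pairwise_markov G X -> local_markov G X.
Proof.
move=> H b; split.
  apply/granger_ci => t E FE; rewrite -finset.setTD.
  have mE : measurable E by exact: (past_sub_sigma [set b]%SET (t + 1)).2.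
  apply: (@ci_setD (fun A => past X A t)).
  - by move=> A; exact: past_sub_sigma.
  - by move=> A B AB; exact: past_mono.
  - by move=> A B; exact: sep_past.
  - exact: past_sub_sigma.
  - by [].
  - by apply: cond_exp_exists; [exact: past_sub_sigma|exact: integ_indic].
  move=> a; rewrite !inE negb_or => /andP[e ab].
  by rewrite finset.setTD; apply: ((granger_ci _ _).1 ((H a b ab).1 e)).
set S := (~: _)%SET; apply: contemp_sym; apply/contemp_ci.
  by rewrite finset.subsetC finset.setCS finset.subsetUr.
move=> t E FE; have -> : (~: ([set b] :|: S) = ~: [set b] :\: S)%SET.
  by apply/setP => v; rewrite !inE negb_or andbC.
have mE : measurable E by exact: (past_sub_sigma [set b]%SET (t + 1)).2.
apply: (@ci_setD (past_next t)).
- by move=> A; exact: past_next_sub_sigma.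
- by move=> A B AB; exact: past_next_mono.
- by move=> A B; exact: sep_past_next.
- exact: past_next_sub_sigma.
- by [].
- by apply: cond_exp_exists; [exact: past_next_sub_sigma|exact: integ_indic].
move=> a; rewrite !inE negb_or => /andP[e ab].
have -> : (~: [set b] :\ a = ~: ([set b] :|: [set a]))%SET.
  by apply/setP => v; rewrite !inE negb_or andbC.
apply: (contemp_ci _).1 FE; first by rewrite finset.sub1set !inE eq_sym.
by apply: contemp_sym; exact: (H a b ab).2 e.
Qed.

(** The directed half is composition over the vertices of [A], whose parents lie
    in [pa G A] or in [A]. The contemporaneous half removes the vertices of [A]
    one by one from the conditioning set of the events of the remaining
    vertices. *)
Lemma local_block : local_markov G X -> block_markov G X.
Proof.
move=> H A; split.
  apply/granger_ci => t; rewrite finset.setCK; apply: comp; first exact: finset.subsetUr.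
  move=> b bA E FE; have := (granger_ci _ _).1 (H b).1 t E FE; rewrite finset.setCK.
  apply: ci_mono => //; apply: past_mono => //; apply/fintype.subsetP => v; rewrite !inE.
  case/orP => [vb|/eqP ->]; last by rewrite bA orbT.
  have [//|vA] := boolP (v \in A).
  by rewrite orbF andTb; apply/bigcupP; exists b => //; rewrite inE.
set C := (~: _)%SET.
have CA : C \subset (~: A)%SET by rewrite finset.setCS finset.subsetUr.
apply/contemp_ci => // t E FE; have -> : (~: (C :|: A) = ~: C :\: A)%SET.
  by apply/setP => v; rewrite !inE negb_or andbC.
have mE : measurable E by exact: (past_sub_sigma C (t + 1)).2.
apply: (@ci_setD (past_next t)).
- by move=> B; exact: past_next_sub_sigma.
- by move=> B B' BB; exact: past_next_mono.
- by move=> B B'; exact: sep_past_next.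
- exact: past_next_sub_sigma.
- by [].
- by apply: cond_exp_exists; [exact: past_next_sub_sigma|exact: integ_indic].
move=> a aA; have -> : (~: C :\ a = ~: (C :|: [set a]))%SET.
  by rewrite finset.setDE finset.setCU.
apply: (contemp_ci _).1 FE; first by rewrite (fintype.subset_trans CA)// finset.setCS finset.sub1set.
apply: contemp_mono (H a).2; first by rewrite finset.setCS finset.subsetUr.
rewrite finset.setCS; apply/fintype.subsetP => v; rewrite !inE.
case/orP => [vb|/eqP ->]; last by rewrite aA orbT.
have [//|vA] := boolP (v \in A).
by rewrite orbF andTb; apply/bigcupP; exists a => //; rewrite inE.
Qed.

End main.

End process.

(** * Moments and characteristic function of a Gaussian variable *)

Section power_series.
Variable R : realType.
Implicit Types (c : nat -> R).

Lemma double_cvg : n.*2 @[n --> \oo] --> \oo.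
Proof.
apply/cvgnyPge => A; near=> n; rewrite -addnn; apply: leq_trans (leq_addr _ _).
by near: n; exact: nbhs_infty_ge.
Unshelve. all: by end_near. Qed.

Lemma sum_double (F : nat -> R) n :
  \sum_(0 <= k < n.*2) F k = \sum_(0 <= j < n) (F j.*2 + F j.*2.+1).
Proof.
elim: n => [|n IH]; first by rewrite !big_geq.
by rewrite doubleS 2?big_nat_recr//= [RHS]big_nat_recr//= -IH addrA.
Qed.

Lemma exp_partial_le (x : R) n : 0 <= x -> \sum_(0 <= k < n) x ^+ k / k`!%:R <= expR x.
Proof.
move=> x0; rewrite -[leLHS]/(series (exp_coeff x) n).
apply: nondecreasing_cvgn_le; last exact: is_cvg_series_exp_coeff.
by apply/nondecreasing_seqP => m; rewrite seriesSr lerDl exp_coeff_ge0.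
Qed.

(** Partial sums of even length suffice for the limit and match series whose odd
    coefficients vanish. If k is the first index with nonzero coefficient,
    dividing by u^k leaves |c_k| <= u C for all small u. *)
Lemma power_series_eq0 c (C : R) : (forall n, \sum_(0 <= k < n) `|c k| <= C) ->
  (forall u : R, 0 < u <= 1 -> \sum_(0 <= k < n.*2) c k * u ^+ k @[n --> \oo] --> 0) ->
  forall k, c k = 0.
Proof.
move=> cC cu; elim/ltn_ind => k IH.
have C0 : 0 <= C by apply: le_trans (cC 0%N); rewrite big_geq.
have bd (u : R) : 0 < u <= 1 -> `|c k| <= u * C.
  move=> /andP[u0 u1]; have u0' := ltW u0.
  have uk : 0 < u ^+ k by rewrite exprn_gt0.
  rewrite -(ler_pM2r uk) -{1}(ger0_norm (ltW uk)) -normrM.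
  have : `|\sum_(0 <= j < n.*2) c j * u ^+ j - c k * u ^+ k| @[n --> \oo] --> `|0 - c k * u ^+ k|.
    by apply: cvg_norm; apply: cvgB; [apply: cu; rewrite u0|exact: cvg_cst].
  rewrite sub0r normrN => cv.
  rewrite -(cvg_lim (@Rhausdorff R) cv); apply: limr_le; first exact: cvgP cv.
  near=> n; have kn : (k < n.*2)%N.
    rewrite -addnn; apply: leq_trans (leq_addr _ _); near: n; exact: nbhs_infty_gt.
  rewrite (@big_cat_nat _ _ _ k)//=; last exact: ltnW.
  have -> : \sum_(0 <= i < k) c i * u ^+ i = 0.
    by rewrite big_nat_cond big1// => i /andP[/andP[_ ik] _]; rewrite IH// mul0r.
  rewrite add0r big_ltn// addrAC subrr add0r.
  rewrite (le_trans (ler_norm_sum _ _ _))//.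
  rewrite mulrC mulrA -exprSr.
  apply: (@le_trans _ _ (u ^+ k.+1 * \sum_(k.+1 <= j < n.*2) `|c j|)).
    rewrite mulr_sumr big_nat_cond [leRHS]big_nat_cond; apply: ler_sum => i /andP[/andP[ki _] _].
    rewrite normrM mulrC ler_wpM2r// ger0_norm ?exprn_ge0//.
    by rewrite -(subnKC ki) exprD ler_piMr ?exprn_ge0 ?exprn_ile1.
  rewrite ler_wpM2l ?exprn_ge0//; apply: le_trans (cC n.*2).
  by rewrite [leRHS](@big_cat_nat _ _ _ k.+1)//= lerDr sumr_ge0.
apply/eqP; rewrite -normr_le0; apply/ler_addgt0Pr => e e0; rewrite add0r.
(* then u C <= e *)
pose u := Num.min 1 (e / (C + 1)).
have C1 : 0 < C + 1 by rewrite ltr_wpDl.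
have u0 : 0 < u by rewrite lt_min ltr01 divr_gt0.
apply: (le_trans (bd u _)); first by rewrite u0 ge_min lexx.
have : u * C <= (e / (C + 1)) * C by rewrite ler_wpM2r// ge_min lexx orbT.
move/le_trans; apply; rewrite mulrAC ler_pdivrMr//.
by apply: ler_wpM2l; [exact: ltW|rewrite lerDl].
Unshelve. all: by end_near. Qed.

End power_series.

Section gaussian_mgf.
Context d (T : measurableType d) (R : realType) (P : probability T R).

Lemma Ex_sum n (c : nat -> R) (f : nat -> T -> R) : (forall k, integ P (f k)) ->
  integ P (fun x => \sum_(0 <= k < n) c k * f k x) /\
  Ex P (fun x => \sum_(0 <= k < n) c k * f k x) = \sum_(0 <= k < n) c k * Ex P (f k).
Proof.
move=> If; elim: n => [|n [IH1 IH2]].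
  rewrite big_geq//; under eq_fun do rewrite big_geq//.
  by split; [apply: bmeas_integ; exact: bmeas_cst|rewrite Ex_cst].
have E x : \sum_(0 <= k < n.+1) c k * f k x =
    1 * (\sum_(0 <= k < n) c k * f k x) + c n * f n x.
  by rewrite mul1r big_nat_recr.
under eq_fun do rewrite E.
split; first exact: integ_lin.
by rewrite Ex_lin// IH2 mul1r [RHS]big_nat_recr.
Qed.

Lemma measurable_expR_scale (W : T -> R) u : measurable_fun setT W ->
  measurable_fun setT (fun x => expR (u * W x)).
Proof.
by move=> mW; apply: measurableT_comp => //; apply: measurable_funM => //; exact: measurable_cst.
Qed.

(** From the moment generating function of the centred normal law of variance
    [q] to its moments, and from there to the expectations of cosine and sine.
    Real power series replace the analytic continuation of E exp(u W) to
    imaginary u. *)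
Variables (W : T -> R) (q : R).
Hypothesis mW : measurable_fun setT W.
Hypothesis q0 : 0 <= q.
Hypothesis iW : forall u : R, integ P (fun x => expR (u * W x)).
Hypothesis mgfW : forall u : R, Ex P (fun x => expR (u * W x)) = expR (u ^+ 2 * q / 2).

Let mX k : measurable_fun setT (fun x => W x ^+ k).
Proof. exact: measurable_funX. Qed.

(** Since exp |W| <= exp W + exp (- W); this variable dominates all partial sums
    of the exponential, cosine and sine series below. *)
Lemma integ_exp_abs : integ P (fun x => expR `|W x|).
Proof.
have I2 := integ_lin 1 1 (iW 1) (iW (-1)).
apply: le_integrable I2 => //.
- by apply/measurable_EFinP; apply: measurableT_comp => //; exact: measurableT_comp.
move=> x _ /=; rewrite lee_fin !mul1r mulN1r.
rewrite (ger0_norm (expR_ge0 _)) [leRHS]ger0_norm ?addr_ge0 ?expR_ge0//.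
have [h|h] := lerP 0 (W x).
  by rewrite ger0_norm// lerDl expR_ge0.
by rewrite ltr0_norm// lerDr expR_ge0.
Qed.

Lemma coef_bound (c : nat -> R) n x : (forall k, `|c k| <= 1) ->
  `|\sum_(0 <= k < n) c k * (W x ^+ k / k`!%:R)| <= expR `|W x|.
Proof.
move=> c1; apply: le_trans (exp_partial_le n (normr_ge0 (W x))).
rewrite (le_trans (ler_norm_sum _ _ _))//; apply: ler_sum => k _.
by rewrite !normrM normrX normfV normr_nat ler_piMl// divr_ge0.
Qed.

Lemma integ_monomial k : integ P (fun x => W x ^+ k / k`!%:R).
Proof.
apply: le_integrable integ_exp_abs => //.
  by apply/measurable_EFinP; apply: measurable_funM => //; exact: measurable_cst.
move=> x _ /=; rewrite lee_fin [leRHS]ger0_norm ?expR_ge0//.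
have := @coef_bound (fun j => (j == k)%:R) k.+1 x.
rewrite big_nat_recr//= eqxx mul1r big_nat_cond big1 ?add0r; last first.
  by move=> i /andP[/andP[_ ik] _]; rewrite (ltn_eqF ik) mul0r.
by apply => j; case: (_ == _); rewrite ?normr1 ?normr0.
Qed.

Definition moment_coef k := Ex P (fun x => W x ^+ k / k`!%:R).

(** Integration term by term of a series dominated by the exponential series. *)
Lemma Ex_power_series (c : nat -> R) (f : R -> R) : (forall k, `|c k| <= 1) ->
  (forall x, \sum_(0 <= k < n.*2) c k * (x ^+ k / k`!%:R) @[n --> \oo] --> f x) ->
  \sum_(0 <= k < n.*2) c k * moment_coef k @[n --> \oo] --> Ex P (f \o W).
Proof.
move=> c1 cf.
have [] := @Ex_dct _ _ _ P (fun n x => \sum_(0 <= k < n.*2) c k * (W x ^+ k / k`!%:R))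
  (f \o W) (fun x => expR `|W x|).
- by move=> n; have [I _] := @Ex_sum n.*2 c _ integ_monomial; exact: integ_meas I.
- exact: integ_exp_abs.
- by move=> x; exact: cf.
- by move=> n x; exact: coef_bound.
move=> _; apply: cvg_trans; apply: near_eq_cvg; apply: nearW => n /=.
by case: (@Ex_sum n.*2 c _ integ_monomial).
Qed.

(** The coefficients of the power series of u |-> exp (u^2 q / 2). *)
Definition gaussian_coef k : R := if odd k then 0 else (q / 2) ^+ k./2 / (k./2)`!%:R.

Lemma sum_gaussian_coef (c : nat -> R) n : \sum_(0 <= k < n.*2) c k * gaussian_coef k =
  \sum_(0 <= j < n) c j.*2 * ((q / 2) ^+ j / j`!%:R).
Proof.
rewrite sum_double; apply: eq_bigr => j _.
by rewrite /gaussian_coef /= odd_double/= mulr0 addr0 doubleK.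
Qed.

(** Both coefficient sequences have the same absolutely convergent power series
    on ]0, 1], the moment generating function. *)
Lemma moment_coefE k : moment_coef k = gaussian_coef k.
Proof.
apply/eqP; rewrite -subr_eq0; apply/eqP.
(* The absolute values of the moments are summed by E exp |W|, the others by
   their series at u = 1. *)
pose C := Ex P (fun x => expR `|W x|) + expR (q / 2).
apply: (@power_series_eq0 _ (fun k => moment_coef k - gaussian_coef k) C).
  move=> n; rewrite (@le_trans _ _ (\sum_(0 <= k < n) `|moment_coef k| + \sum_(0 <= k < n) `|gaussian_coef k|))//.
    by rewrite -big_split; apply: ler_sum => i _; exact: ler_normB.
  apply: lerD.
    (* the absolute value is taken outside the expectation, by signs in the
       coefficients *)
    pose sg i : R := Num.sg (moment_coef i).
    have -> : \sum_(0 <= k < n) `|moment_coef k| = \sum_(0 <= k < n) sg k * moment_coef k.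
      by apply: eq_bigr => i _; rewrite /sg -normrEsg.
    have [Is <-] := @Ex_sum n sg _ integ_monomial.
    apply: le_Ex => //; first exact: integ_exp_abs.
    move=> x; rewrite (le_trans (ler_norm _))//; apply: coef_bound => i.
    by rewrite normr_sg; case: (_ != _).
  apply: (@le_trans _ _ (\sum_(0 <= k < n.*2) `|gaussian_coef k|)).
    rewrite [leRHS](@big_cat_nat _ _ _ n)//= ?lerDl ?sumr_ge0//.
    by rewrite -addnn leq_addr.
  rewrite -[leLHS](eq_bigr _ (fun i _ => mul1r _)).
  have bb i : `|gaussian_coef i| = gaussian_coef i.
    by rewrite ger0_norm// /gaussian_coef; case: ifP => // _; rewrite divr_ge0// exprn_ge0// divr_ge0.
  under eq_bigr do rewrite bb.
  rewrite (sum_gaussian_coef (fun=> 1)); under eq_bigr do rewrite mul1r.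
  by apply: exp_partial_le; rewrite divr_ge0.
move=> u /andP[u0 u1].
have -> : (fun n => \sum_(0 <= k < n.*2) (moment_coef k - gaussian_coef k) * u ^+ k) =
    (fun n => \sum_(0 <= k < n.*2) u ^+ k * moment_coef k - \sum_(0 <= k < n.*2) u ^+ k * gaussian_coef k).
  apply/funext => n; rewrite -sumrB; apply: eq_bigr => i _; ring.
rewrite -[X in _ --> X](subrr (expR (u ^+ 2 * q / 2))); apply: cvgB.
  rewrite -mgfW; apply: (@Ex_power_series _ (fun x => expR (u * x))).
    by move=> i; have u0' := ltW u0; rewrite ger0_norm ?exprn_ge0 ?exprn_ile1.
  move=> x; have /(cvg_comp _ _ double_cvg) := is_cvg_series_exp_coeff (u * x).
  apply: cvg_trans; apply: near_eq_cvg; apply: nearW => n /=.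
  by rewrite /series/=; apply: eq_bigr => i _; rewrite /exp_coeff/= exprMn mulrA.
have := is_cvg_series_exp_coeff (u ^+ 2 * q / 2).
apply: cvg_trans; apply: near_eq_cvg; apply: nearW => n /=.
rewrite sum_gaussian_coef /series/=; apply: eq_bigr => i _.
by rewrite /exp_coeff/= -mulrA exprMn -exprM mul2n mulrA.
Qed.

Lemma gaussian_Ex : Ex P W = 0.
Proof.
have := moment_coefE 1; rewrite /moment_coef /gaussian_coef/= => <-.
by apply: Ex_ext => x; rewrite expr1 divr1.
Qed.

Lemma gaussian_integ : integ P W.
Proof. by apply: integ_ext (integ_monomial 1) => x; rewrite expr1 divr1. Qed.

Lemma gaussian_integ2 : integ P (fun x => W x ^+ 2).
Proof.
have := integ_lin 2 0 (integ_monomial 2) (integ_monomial 2); apply: integ_ext => x.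
by rewrite mul0r addr0 (_ : 2`!%:R = 2 :> R)// mulrC divfK.
Qed.

Lemma gaussian_Ex2 : Ex P (fun x => W x ^+ 2) = q.
Proof.
have := moment_coefE 2; rewrite /moment_coef /gaussian_coef/= expr1 divr1 => e.
transitivity (2 * Ex P (fun x => W x ^+ 2 / 2`!%:R) + 0 * Ex P (fun x => W x ^+ 2 / 2`!%:R)).
  rewrite -Ex_lin; [|exact: integ_monomial..]; apply: Ex_ext => x.
  by rewrite mul0r addr0 (_ : 2`!%:R = 2 :> R)// mulrC divfK.
by rewrite e mul0r addr0 mulrC divfK.
Qed.

Lemma gaussian_cos : Ex P (fun x => cos (W x)) = expR (- q / 2).
Proof.
pose c k : R := if odd k then 0 else (-1) ^+ k./2.
have c1 k : `|c k| <= 1.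
  by rewrite /c; case: ifP; rewrite ?normr0// normrX normrN1 expr1n.
have h1 : \sum_(0 <= k < n.*2) c k * moment_coef k @[n --> \oo] --> Ex P (@cos R \o W).
  apply: Ex_power_series => // x; have := @cvg_cos_coeff' R x.
  apply: cvg_trans; apply: near_eq_cvg; apply: nearW => n /=.
  rewrite sum_double /series/=; apply: eq_bigr => i _.
  by rewrite /c /= odd_double/= mul0r addr0 doubleK /cos_coeff' mulrA.
have h2 : \sum_(0 <= k < n.*2) c k * moment_coef k @[n --> \oo] --> expR (- q / 2).
  have := is_cvg_series_exp_coeff (- q / 2).
  apply: cvg_trans; apply: near_eq_cvg; apply: nearW => n /=.
  under eq_bigr do rewrite moment_coefE.
  rewrite sum_gaussian_coef /series/=; apply: eq_bigr => i _.
  by rewrite /c odd_double doubleK mulrA -exprMn mulN1r mulNr.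
exact: (cvg_unique _ h1 h2).
Qed.

Lemma gaussian_sin : Ex P (fun x => sin (W x)) = 0.
Proof.
pose c k : R := if odd k then (-1) ^+ k./2 else 0.
have c1 k : `|c k| <= 1.
  by rewrite /c; case: ifP; rewrite ?normr0// normrX normrN1 expr1n.
have h1 : \sum_(0 <= k < n.*2) c k * moment_coef k @[n --> \oo] --> Ex P (@sin R \o W).
  apply: Ex_power_series => // x; have := @cvg_sin_coeff' R x.
  apply: cvg_trans; apply: near_eq_cvg; apply: nearW => n /=.
  rewrite sum_double /series/=; apply: eq_bigr => i _.
  by rewrite /c /= odd_double/= mul0r add0r uphalf_double /sin_coeff' mulrA.
have h2 : \sum_(0 <= k < n.*2) c k * moment_coef k @[n --> \oo] --> (0 : R).
  rewrite (_ : (fun n => _) = fun=> 0); first exact: cvg_cst.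
  apply/funext => n; under eq_bigr do rewrite moment_coefE.
  rewrite sum_gaussian_coef big1// => i _.
  by rewrite /c odd_double mul0r.
exact: (cvg_unique _ h1 h2).
Qed.

End gaussian_mgf.

Section normal_mgf.
Variable R : realType.
Local Notation mu := (@lebesgue_measure R).

Lemma measurable_expR_lin (u : R) :
  measurable_fun [set: R] (fun x : R => (expR (u * x))%:E).
Proof.
apply/measurable_EFinP; apply: measurableT_comp; first by [].
by apply: measurable_funM; [exact: measurable_cst|exact: measurable_id].
Qed.

(** The normal law is dominated by the Lebesgue measure, and its Radon-Nikodym
    derivative is almost everywhere the density. *)
Lemma ge0_integral_normal_prob (m s : R) (f : R -> \bar R) :
  measurable_fun setT f -> (forall x, (0 <= f x)%E) ->
  (\int[normal_prob m s]_x f x = \int[mu]_x (f x * (normal_pdf m s x)%:E))%E.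
Proof.
move=> mf f0; have dom := normal_prob_dominates m s.
rewrite -(Radon_Nikodym_SigmaFinite.change_of_variables dom f0 measurableT mf).
have mpdf : measurable_fun setT (EFin \o normal_pdf m s).
  by apply/measurable_EFinP; exact: measurable_normal_pdf.
have mRN := measurable_int _ (Radon_Nikodym_SigmaFinite.f_integrable dom).
apply: ae_eq_integral => //; [exact: emeasurable_funM|exact: emeasurable_funM|].
have : ae_eq mu setT (Radon_Nikodym_SigmaFinite.f (normal_prob m s) mu) (EFin \o normal_pdf m s).
  apply: integral_ae_eq => //; first exact: Radon_Nikodym_SigmaFinite.f_integrable.
  by move=> A _ mA; rewrite -Radon_Nikodym_SigmaFinite.f_integral.
by apply: filterS => x h _ /=; rewrite h.
Qed.

(** Completing the square in the exponent: exponential tilting shifts the mean. *)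
Lemma normal_pdf_tilt (m s u x : R) : s != 0 ->
  expR (u * x) * normal_pdf m s x =
  expR (u * m + u ^+ 2 * s ^+ 2 / 2) * normal_pdf (m + u * s ^+ 2) s x.
Proof.
move=> s0; rewrite !normal_pdfE// mulrCA [RHS]mulrCA; congr (_ * _).
rewrite /normal_fun -!expRD; congr expR; field.
by rewrite s0.
Qed.

Lemma normal_mgf (m s u : R) : s != 0 ->
  (\int[normal_prob m s]_x (expR (u * x))%:E = (expR (u * m + u ^+ 2 * s ^+ 2 / 2))%:E)%E.
Proof.
move=> s0; rewrite ge0_integral_normal_prob; last 2 first.
- exact: measurable_expR_lin.
- by move=> x; rewrite lee_fin expR_ge0.
under eq_integral do rewrite -EFinM normal_pdf_tilt// EFinM.
rewrite integralZl//; last exact: integrable_normal_pdf.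
by rewrite integral_normal_pdf mule1.
Qed.

(** The Dirac case s = 0 has q = 0. *)
Lemma gaussian_law_mgf d (T : measurableType d) (P : probability T R) (W : T -> R) :
  measurable_fun setT W -> is_gaussian_law (pushforward P W) ->
  exists m q : R, 0 <= q /\ forall u : R, integ P (fun x => expR (u * W x)) /\
    Ex P (fun x => expR (u * W x)) = expR (u * m + u ^+ 2 * q / 2).
Proof.
move=> mW [m [s law]]; exists m, (s ^+ 2); split; first exact: sqr_ge0.
move=> u.
have mexp := measurable_expR_lin u.
have E : (\int[P]_x (expR (u * W x))%:E = (expR (u * m + u ^+ 2 * s ^+ 2 / 2))%:E)%E.
  transitivity (\int[@pushforward _ _ T (measurableTypeR R) R P W]_x (expR (u * x))%:E)%E.
    by rewrite (@ge0_integral_pushforward _ _ T (measurableTypeR R) R W mW)// => x _; rewrite lee_fin expR_ge0.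
  have [s0|s0] := eqVneq s 0.
    rewrite (@eq_measure_integral _ (measurableTypeR R) R setT (@dirac _ (measurableTypeR R) m R)); last first.
      by move=> A mA _; have := law A mA; rewrite s0 eqxx; exact.
    rewrite integral_dirac// diracT mul1e.
    by rewrite s0 expr0n/= mulr0 mul0r addr0.
  transitivity (\int[normal_prob m s]_x (expR (u * x))%:E)%E; last exact: normal_mgf.
  apply: eq_measure_integral => A mA _; have := law A mA; rewrite (negbTE s0); exact.
split; last by rewrite /Ex /Rintegral E.
apply/integrableP; split.
  by apply/measurable_EFinP; exact: measurable_expR_scale.
under eq_integral do rewrite /= ger0_norm ?expR_ge0//.
by rewrite E ltry.
Qed.

End normal_mgf.

(** * Independence in Gaussian spaces *)

Lemma measurable_cos (R : realType) : measurable_fun setT (@cos R).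
Proof. by apply: continuous_measurable_fun; exact: continuous_cos. Qed.

Lemma measurable_sin (R : realType) : measurable_fun setT (@sin R).
Proof. by apply: continuous_measurable_fun; exact: continuous_sin. Qed.

Section trig_functions.
Context (T : pointedType) (R : realType) (L : set (T -> R)).

Definition linear_space := L (fun=> 0) /\
  forall a b f g, L f -> L g -> L (fun x => a * f x + b * g x).

(** The real counterpart of the characters exp (i W), [W] in [L]. *)
Definition trig : set (T -> R) := [set f | exists2 W, L W &
  f = (fun x => cos (W x)) \/ f = (fun x => sin (W x))].

Hypothesis LL : linear_space.

Lemma trig1 : trig (fun=> 1).
Proof.
exists (fun=> 0); first exact: LL.1.
by left; apply/funext => x; rewrite cos0.
Qed.

Lemma trig_le1 f : trig f -> forall x, `|f x| <= 1.
Proof. by move=> [W _ [->|->]] x; [exact: cos_max|exact: sin_max]. Qed.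

(** By the product-to-sum formulas, products of cosines and sines of elements of
    the linear space [L] are combinations of two such functions. *)
Lemma trigM f g : trig f -> trig g -> bclos trig (fun x => f x * g x).
Proof.
have tc W : L W -> bclos trig (fun x => cos (W x)).
  by move=> LW; apply: bclos_gen; exists W => //; left.
have ts W : L W -> bclos trig (fun x => sin (W x)).
  by move=> LW; apply: bclos_gen; exists W => //; right.
move=> [U LU fU] [W LW gW].
have LP := LL.2 1 1 _ _ LU LW; have LM := LL.2 1 (-1) _ _ LU LW.
have e1 x : 1 * U x + 1 * W x = U x + W x by rewrite !mul1r.
have e2 x : 1 * U x + -1 * W x = U x - W x by rewrite mul1r mulN1r.
case: fU gW => -> [] ->.
- apply: (bclos_ext (bclos_lin (1/2) (1/2) (tc _ LP) (tc _ LM))) => x /=.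
  by rewrite e1 e2 cosD cosB; field.
- apply: (bclos_ext (bclos_lin (1/2) (-1/2) (ts _ LP) (ts _ LM))) => x /=.
  by rewrite e1 e2 sinD sinB; field.
- apply: (bclos_ext (bclos_lin (1/2) (1/2) (ts _ LP) (ts _ LM))) => x /=.
  by rewrite e1 e2 sinD sinB; field.
- apply: (bclos_ext (bclos_lin (1/2) (-1/2) (tc _ LM) (tc _ LP))) => x /=.
  by rewrite e2 e1 cosB cosD; field.
Qed.

Let trig_bounded f : trig f -> exists C : R, forall x, `|f x| <= C.
Proof. by move=> /trig_le1; exists 1. Qed.

(** A sigma-algebra containing the one generated by [L]
    ([linear_space_trig_mble]), whose indicators are bounded limits of
    trigonometric polynomials by definition. *)
Definition trig_sets : set (set T) := [set A | bclos trig (\1_A)].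

Lemma trig_sets_sigma : sigma_algebra setT trig_sets.
Proof. exact: (bclos_sigma trig1 trig_bounded trigM). Qed.

Lemma bclos_trig_mble f : bclos trig f -> mble trig_sets f.
Proof.
move=> Mf; apply/mbleP; first exact: trig_sets_sigma.
apply: (measurability _ (RGenOInfty.measurableE R)) => //.
move=> _ [_ [a ->] <-]; rewrite setTI /measurable/= sigma_algebra_id; last exact: trig_sets_sigma.
have := bclos_indic_gt trig1 trig_bounded trigM a Mf.
rewrite /trig_sets/=; congr bclos; congr indic; apply/seteqP.
by split => x /=; rewrite in_itv/= andbT.
Qed.

Lemma cvg_sin_scale (w : R) : n.+1%:R * sin (w / n.+1%:R) @[n --> \oo] --> w.
Proof.
have [->|w0] := eqVneq w 0.
  rewrite (_ : (fun n => _) = fun=> 0); first exact: cvg_cst.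
  by apply/funext => n; rewrite mul0r sin0 mulr0.
have h : w / n.+1%:R @[n --> \oo] --> (0 : R).
  rewrite -[X in _ --> X](mulr0 w); apply: cvgM; first exact: cvg_cst.
  exact: cvg_harmonic.
have [/cvg_ex[l cl] dl] := is_derive_sin (0 : R).
have {dl} l1 : l = 1.
  by rewrite -cos0 -dl; apply/esym/cvg_lim => //.
rewrite l1 in cl.
have n0 n : n.+1%:R != 0 :> R by rewrite pnatr_eq0.
have h' : w / n.+1%:R @[n --> \oo] --> (0 : R)^'.
  move=> A nA; have := h (fun y => y != 0 -> A y) nA.
  rewrite /nbhs/=; apply: filterS => n /=; apply.
  by rewrite mulf_neq0// invr_neq0.
have cv := cvg_comp _ _ h' cl.
have : w * ((w / n.+1%:R)^-1 *: (sin (w / n.+1%:R)%:A - sin (0 : R))) @[n --> \oo] --> w * 1.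
  apply: cvgM; first exact: cvg_cst.
  move: cv; apply: cvg_trans; apply: near_eq_cvg; apply: nearW => n /=.
  by rewrite addr0.
rewrite mulr1; apply: cvg_trans; apply: near_eq_cvg; apply: nearW => n /=.
by rewrite sin0 subr0 /GRing.scale/= mulr1 invf_div mulrA [w * _]mulrC divfK.
Qed.

(** [W] itself is not bounded, but it is the limit of n sin (W / n), which lie
    in the linear span of [trig L]. *)
Lemma linear_space_trig_mble W : L W -> mble trig_sets W.
Proof.
move=> LW; apply/mbleP; first exact: trig_sets_sigma.
apply: (@measurable_fun_cvg _ (g_sigma_algebraType trig_sets) _ _
  (fun n x => n.+1%:R * sin (W x / n.+1%:R))); last by move=> x _; exact: cvg_sin_scale.
move=> n; apply/mbleP; first exact: trig_sets_sigma.
apply: bclos_trig_mble.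
have LWn := LL.2 n.+1%:R^-1 0 _ _ LW LW.
have Ms : bclos trig (fun x => sin (n.+1%:R^-1 * W x + 0 * W x)).
  by apply: bclos_gen; eexists; [exact: LWn|right].
apply: (bclos_ext (bclos_lin n.+1%:R 0 Ms Ms)) => x.
by rewrite !mul0r !addr0 [_^-1 * _]mulrC.
Qed.

End trig_functions.

Section gaussian_space.
Context d (T : measurableType d) (R : realType) (P : probability T R).
Implicit Types (H S : set (T -> R)) (f g W L M Y : T -> R).

(** What is used of a centred Gaussian variable: two moments and the value of
    the characteristic function at 1. Its values elsewhere come from multiples
    of [W] in the same linear space. *)
Definition gaussian_like W := [/\ measurable_fun setT W, integ P W,
  integ P (fun x => W x ^+ 2), Ex P W = 0 &
  Ex P (fun x => cos (W x)) = expR (- Ex P (fun x => W x ^+ 2) / 2) /\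
  Ex P (fun x => sin (W x)) = 0].

Definition gaussian_family H := linear_space H /\ forall W, H W -> gaussian_like W.

Section fixed_space.
Variable H : set (T -> R).
Hypothesis HH : gaussian_family H.

Let HL a b f g : H f -> H g -> H (fun x => a * f x + b * g x).
Proof. exact: HH.1.2. Qed.

Let sq_int f : H f -> integ P (fun x => f x ^+ 2).
Proof. by move=> /HH.2[]. Qed.

(** By polarization. *)
Lemma gaussian_integM f g : H f -> H g -> integ P (fun x => f x * g x).
Proof.
move=> Hf Hg.
have := integ_lin (1/4) (-1/4) (sq_int (HL 1 1 Hf Hg)) (sq_int (HL 1 (-1) Hf Hg)).
by apply: integ_ext => x; field.
Qed.

Lemma gaussian_Ex_sqr a b f g : H f -> H g -> Ex P (fun x => (a * f x + b * g x) ^+ 2) =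
  a ^+ 2 * Ex P (fun x => f x ^+ 2) + 2 * a * b * Ex P (fun x => f x * g x) +
  b ^+ 2 * Ex P (fun x => g x ^+ 2).
Proof.
move=> Hf Hg.
have If := sq_int Hf; have Ig := sq_int Hg; have Ifg := gaussian_integM Hf Hg.
transitivity (Ex P (fun x => 1 * (a ^+ 2 * f x ^+ 2 + (2 * a * b) * (f x * g x)) +
  b ^+ 2 * g x ^+ 2)).
  by apply: Ex_ext => x; ring.
by rewrite Ex_lin//; [rewrite Ex_lin// mul1r|exact: integ_lin].
Qed.

Lemma gaussian_Ex_linl a b f g h : H f -> H g -> H h -> Ex P (fun x => (a * f x + b * g x) * h x) =
  a * Ex P (fun x => f x * h x) + b * Ex P (fun x => g x * h x).
Proof.
move=> Hf Hg Hh; rewrite -Ex_lin; [|exact: gaussian_integM|exact: gaussian_integM].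
by apply: Ex_ext => x; ring.
Qed.

Lemma gaussian_trig_bmeas W : H W -> bmeas (fun x => cos (W x)) /\ bmeas (fun x => sin (W x)).
Proof.
move=> /HH.2[mW _ _ _ _].
split; split.
- exact: measurableT_comp (@measurable_cos R) mW.
- by exists 1 => x; exact: cos_max.
- exact: measurableT_comp (@measurable_sin R) mW.
- by exists 1 => x; exact: sin_max.
Qed.

(** With K = E cos L E cos M and i = E[LM], the Gaussian formulas give E cos (L
    + M) = K exp (- i) and E cos (L - M) = K exp i. For i = 0 the covariances
    vanish; the quantitative form is needed because the residual of the
    projection is only a limit of elements of the Gaussian family. *)
Lemma trig_near_uncorrelated L M (phi psi : R -> R) : H L -> H M ->
  phi = @cos R \/ phi = @sin R -> psi = @cos R \/ psi = @sin R ->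
  `|Ex P (fun x => phi (L x) * psi (M x)) -
    Ex P (fun x => phi (L x)) * Ex P (fun x => psi (M x))| <=
  `|expR (Ex P (fun x => L x * M x)) - 1| + `|expR (- Ex P (fun x => L x * M x)) - 1|.
Proof.
move=> HL' HM hphi hpsi; set i := Ex P (fun x => L x * M x).
set a := Ex P (fun x => L x ^+ 2); set b := Ex P (fun x => M x ^+ 2).
have [_ _ _ _ [cL sL]] := HH.2 _ HL'; have [_ _ _ _ [cM sM]] := HH.2 _ HM.
have Hp := HL 1 1 HL' HM; have Hm := HL 1 (-1) HL' HM.
have [_ _ _ _ [cp sp]] := HH.2 _ Hp; have [_ _ _ _ [cm sm]] := HH.2 _ Hm.
have [bcp bsp] := gaussian_trig_bmeas Hp; have [bcm bsm] := gaussian_trig_bmeas Hm.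
rewrite gaussian_Ex_sqr// -/a -/b -/i in cp; rewrite gaussian_Ex_sqr// -/a -/b -/i in cm.
rewrite -/a in cL; rewrite -/b in cM.
have a0 : 0 <= a by apply: Ex_ge0 => x; exact: sqr_ge0.
have b0 : 0 <= b by apply: Ex_ge0 => x; exact: sqr_ge0.
pose K := expR (- a / 2) * expR (- b / 2).
have K01 : `|K| <= 1.
  rewrite ger0_norm ?mulr_ge0 ?expR_ge0// mulr_ile1 ?expR_ge0//.
    by rewrite expR_le1 mulNr oppr_le0 divr_ge0.
  by rewrite expR_le1 mulNr oppr_le0 divr_ge0.
have {}cp : Ex P (fun x => cos (1 * L x + 1 * M x)) = K * expR (- i).
  by rewrite cp /K -!expRD; congr expR; field.
have {}cm : Ex P (fun x => cos (1 * L x + -1 * M x)) = K * expR i.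
  by rewrite cm /K -!expRD; congr expR; field.
have lin s t (f g h : T -> R) : bmeas f -> bmeas g -> (forall x, h x = s * f x + t * g x) ->
    Ex P h = s * Ex P f + t * Ex P g.
  by move=> bf bg hE; rewrite -Ex_lin; [exact: Ex_ext|exact: bmeas_integ..].
have eB x : 1 * L x + -1 * M x = L x - M x by rewrite mul1r mulN1r.
have eD x : 1 * L x + 1 * M x = L x + M x by rewrite !mul1r.
have R0 : 0 <= `|expR i - 1| + `|expR (- i) - 1| by rewrite addr_ge0.
have sc x : sin (L x) * cos (M x) = (1/2) * sin (1 * L x + 1 * M x) + (1/2) * sin (1 * L x + -1 * M x).
  by rewrite eB eD sinB sinD; field.
have cs x : cos (L x) * sin (M x) = (1/2) * sin (1 * L x + 1 * M x) + (-1/2) * sin (1 * L x + -1 * M x).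
  by rewrite eB eD sinB sinD; field.
case: hphi hpsi => -> [] ->.
- rewrite (lin (1/2) (1/2) _ _ _ bcp bcm); last first.
    by move=> x; rewrite eB eD cosB cosD; field.
  rewrite cp cm cL cM -/K.
  have -> : 1 / 2 * (K * expR (- i)) + 1 / 2 * (K * expR i) - K =
      K * ((expR i - 1) + (expR (- i) - 1)) / 2 by field.
  rewrite normrM normfV normrM (ger0_norm (ler0n _ 2)).
  apply: (@le_trans _ _ (1 * (`|expR i - 1| + `|expR (- i) - 1|) / 2)).
    by rewrite ler_wpM2r ?invr_ge0// ler_pM// ler_normD.
  lra.
- rewrite (lin _ _ _ _ _ bsp bsm cs) sp sm sM !mulr0 addr0 subrr normr0.
  exact: R0.
- by rewrite (lin _ _ _ _ _ bsp bsm sc) sp sm sL !mulr0 mul0r addr0 subrr normr0.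
- rewrite (lin (1/2) (-1/2) _ _ _ bcm bcp); last first.
    by move=> x; rewrite eB eD cosB cosD; field.
  rewrite cp cm sL mul0r subr0.
  have -> : 1 / 2 * (K * expR i) + - 1 / 2 * (K * expR (- i)) =
      K * ((expR i - 1) - (expR (- i) - 1)) / 2 by field.
  rewrite normrM normfV normrM (ger0_norm (ler0n _ 2)).
  apply: (@le_trans _ _ (1 * (`|expR i - 1| + `|expR (- i) - 1|) / 2)).
    by rewrite ler_wpM2r ?invr_ge0// ler_pM// ler_normB.
  lra.
Qed.

Section projection.
Variable S : set (T -> R).
Hypothesis SL : linear_space S.
Hypothesis SH : S `<=` H.

(* Half powers give summable increments in the square mean, hence almost sure
   convergence below. *)
Local Notation h n := ((1 / 2 : R) ^+ n).

(** Approximate orthogonal projection of [Y] on [S]: z n comes within 4^-n of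
    the infimum of E[(Y - z)^2]. The parallelogram identity for z n and z (n+1),
    with their mean in [S], bounds the increments, and comparison with z n + s W
    for s = 2^-n and s = - 2^-n bounds the scalar product of Y - z n with W. *)
Lemma minimizing_sequence Y : H Y -> exists z : nat -> T -> R,
  [/\ forall n, S (z n),
      forall n, Ex P (fun x => (1 * z n.+1 x + -1 * z n x) ^+ 2) <= 4 * (h n * h n) &
      forall n W, S W -> `|Ex P (fun x => (1 * Y x + -1 * z n x) * W x)| <=
        h n * (1 + Ex P (fun x => W x ^+ 2))].
Proof.
move=> HY; pose N z := Ex P (fun x => (1 * Y x + -1 * z x) ^+ 2).
pose E := [set N z | z in S]; pose dd := inf E.
have lbE : lbound E 0 by move=> _ [z _ <-]; apply: Ex_ge0 => x; exact: sqr_ge0.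
have hE : has_inf E by split; [exists (N (fun=> 0)), (fun=> 0) => //; exact: SL.1|exists 0].
have dle z : S z -> dd <= N z by move=> Sz; apply: ge_inf; [exists 0|exists z].
have h0 n : 0 < h n by rewrite exprn_gt0.
have ex n : exists z, S z /\ N z < dd + h n * h n.
  have [_ [z Sz <-] Nz] := inf_adherent (mulr_gt0 (h0 n) (h0 n)) hE.
  by exists z.
pose z n := sval (cid (ex n)).
have Sz n : S (z n) by have [] := svalP (cid (ex n)).
have Nz n : N (z n) < dd + h n * h n by have [] := svalP (cid (ex n)).
have Hz n : H (z n) by exact: SH.
exists z; split => //.
- move=> n.
  have := dle _ (SL.2 (1/2) (1/2) _ _ (Sz n.+1) (Sz n)).
  have := Nz n; have := Nz n.+1; rewrite /N.
  rewrite (gaussian_Ex_sqr 1 (-1) HY (HL (1/2) (1/2) (Hz n.+1) (Hz n))) !gaussian_Ex_sqr//.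
  have -> : Ex P (fun x => Y x * (1 / 2 * z n.+1 x + 1 / 2 * z n x)) =
     1/2 * Ex P (fun x => Y x * z n.+1 x) + 1/2 * Ex P (fun x => Y x * z n x).
    rewrite -Ex_lin; [|exact: gaussian_integM|exact: gaussian_integM].
    by apply: Ex_ext => x; ring.
  have -> : h n.+1 * h n.+1 = h n * h n / 4 by rewrite exprS; field.
  rewrite (_ : (1 / 2 : R) ^+ 2 = 1 / 4); last by field.
  rewrite expr1n sqrrN expr1n; have := mulr_gt0 (h0 n) (h0 n); set hh := h n * h n; lra.
- move=> n W SW; have HW := SH SW.
  have HYz := HL 1 (-1) HY (Hz n).
  set i := Ex P _; set w := Ex P (fun x => W x ^+ 2).
  have key s : 2 * s * i <= h n * h n + s ^+ 2 * w.
    have := dle _ (SL.2 1 s _ _ (Sz n) SW).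
    have -> : N (fun x => 1 * z n x + s * W x) =
        Ex P (fun x => (1 * (1 * Y x + -1 * z n x) + (- s) * W x) ^+ 2).
      by apply: Ex_ext => x; ring.
    rewrite (gaussian_Ex_sqr 1 (- s) HYz HW) -/i -/w.
    have := Nz n; rewrite /N; nra.
  have := key (h n); have := key (- h n); have := h0 n.
  have w0 : 0 <= w by apply: Ex_ge0 => x; exact: sqr_ge0.
  rewrite ler_norml => hn k1 k2; apply/andP; split.
    rewrite -(ler_pM2l hn); nra.
  rewrite -(ler_pM2l hn); nra.
Qed.

Lemma sum_half n : \sum_(0 <= k < n) h k = 2 - 2 * h n.
Proof.
elim: n => [|n IH]; first by rewrite big_geq// expr0 mulr1 subrr.
by rewrite big_nat_recr//= IH exprS; field.
Qed.

(** The L^1-norms of the increments are summable, so the series of absolute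
    increments is almost surely finite; z n then converges, dominated by |z 0|
    and that series. Taking the upper limit everywhere yields a [G]-measurable
    limit. *)
Lemma fast_sequence_limit (G : set (set T)) (z : nat -> T -> R) : sub_sigma G ->
  (forall n, H (z n)) -> (forall n, mble G (z n)) ->
  (forall n, Ex P (fun x => (1 * z n.+1 x + -1 * z n x) ^+ 2) <= 4 * (h n * h n)) ->
  exists m, [/\ mble G m, integ P m, Ex P m = 0 &
    {ae P, forall x, z n x @[n --> \oo] --> m x}].
Proof.
move=> sG Hz Gz zz.
pose dz n x := `|z n.+1 x - z n x|.
have Hd n := HL 1 (-1) (Hz n.+1) (Hz n).
have mz n : measurable_fun setT (z n) by have [] := HH.2 _ (Hz n).
have mdz n : measurable_fun setT (dz n).
  by apply: measurableT_comp => //; exact: measurable_funB.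
have h0 n : 0 < h n by rewrite exprn_gt0.
have Idz n : integ P (dz n).
  have [_ I1 _ _ _] := HH.2 _ (Hd n).
  by have := integrable_norm I1; apply: integ_ext => x /=; rewrite /dz mul1r mulN1r.
(* d <= h/2 + d^2/(2h), with E d^2 <= 4 h^2, gives h/2 + 2 h = 5/2 h; the h's
   sum to at most 2, hence the bound 5 below. *)
have Edz n : Ex P (dz n) <= 5 / 2 * h n.
  have I2 := sq_int (Hd n).
  have := @le_Ex _ _ _ P (dz n)
    (fun x => (h n / 2) * 1 + (2 * h n)^-1 * (1 * z n.+1 x + -1 * z n x) ^+ 2) (Idz n).
  have I1 := bmeas_integ P (bmeas_cst T (1 : R)).
  move=> /(_ (integ_lin _ _ I1 I2)) H1.
  apply: le_trans (H1 _) _.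
    move=> x; have -> : (1 * z n.+1 x + -1 * z n x) ^+ 2 = dz n x ^+ 2.
      by rewrite /dz real_normK ?num_real// mul1r mulN1r.
    have hn := h0 n; have d0 : 0 <= dz n x by exact: normr_ge0.
    rewrite -(ler_pM2l (mulr_gt0 (ltr0n R 2 : 0 < 2) hn)).
    have -> : 2 * h n * (h n / 2 * 1 + (2 * h n)^-1 * dz n x ^+ 2) = h n * h n + dz n x ^+ 2.
      by field; rewrite gt_eqF.
    rewrite -subr_ge0; have -> : h n * h n + dz n x ^+ 2 - 2 * h n * dz n x = (h n - dz n x) ^+ 2 by ring.
    exact: sqr_ge0.
  rewrite Ex_lin// Ex_cst mulr1.
  have := zz n; have hn := h0 n => zzn.
  have : (2 * h n)^-1 * Ex P (fun x => (1 * z n.+1 x + -1 * z n x) ^+ 2) <=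
    (2 * h n)^-1 * (4 * (h n * h n)).
    by rewrite ler_wpM2l// invr_ge0 mulr_ge0// ltW.
  have -> : (2 * h n)^-1 * (4 * (h n * h n)) = 2 * h n by field; rewrite gt_eqF.
  lra.
pose D x := (\sum_(0 <= n <oo) (dz n x)%:E)%E.
have mD : measurable_fun setT D.
  apply: (@ge0_emeasurable_sum _ T R setT (fun n x => (dz n x)%:E) xpredT).
    by move=> k x _ _; rewrite lee_fin normr_ge0.
  by move=> k _; exact/measurable_EFinP.
have D0 x : (0 <= D x)%E by apply: nneseries_ge0 => n _ _; rewrite lee_fin normr_ge0.
have ID : P.-integrable setT D.
  apply/integrableP; split => //.
  under eq_integral do rewrite gee0_abs//.
  rewrite /D integral_nneseries//; last 2 first.
  - by move=> n; exact/measurable_EFinP.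
  - by move=> n x _; rewrite lee_fin normr_ge0.
  apply: (@le_lt_trans _ _ 5%:E); last exact: ltry.
  apply: lime_le.
    by apply: is_cvg_nneseries => n _ _; apply: integral_ge0 => x _; rewrite lee_fin normr_ge0.
  apply: nearW => n.
  apply: (@le_trans _ _ (\sum_(0 <= k < n) (5 / 2 * h k)%:E)%E).
    apply: lee_sum => k _; have := Edz k; rewrite -lee_fin /Ex /Rintegral fineK//.
    exact: integrable_fin_num (Idz k).
  rewrite sumEFin lee_fin -mulr_sumr sum_half.
  have := h0 n; lra.
have Dfin : {ae P, forall x, D x \is a fin_num}.
  by have := integrable_ae measurableT ID; apply: filterS => x; exact.
have part x n : D x \is a fin_num -> \sum_(0 <= k < n) dz k x <= fine (D x).
  move=> Dx; rewrite -lee_fin fineK// -sumEFin; apply: nneseries_lim_ge => k _ _.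
  by rewrite lee_fin normr_ge0.
have zcv x : D x \is a fin_num -> cvgn (z ^~ x).
  move=> Dx.
  have c0 : cvgn (series (fun n => dz n x)).
    apply: nondecreasing_is_cvgn.
      by apply/nondecreasing_seqP => n; rewrite seriesSr lerDl; exact: normr_ge0.
    by exists (fine (D x)) => _ [n _ <-]; exact: part.
  have c1 : cvgn [normed series (telescope (z ^~ x))] by exact: c0.
  have := normed_cvg c1; rewrite telescopeK => /cvg_ex[l cl].
  apply/cvg_ex; exists (l + z 0%N x).
  rewrite (_ : z ^~ x = fun n => (z n x - z 0%N x) + z 0%N x).
    by apply: cvgD; [exact: cl|exact: cvg_cst].
  by apply/funext => n; rewrite subrK.
pose m x := fine (limn_esup (fun n => (z n x)%:E)).
have zm x : D x \is a fin_num -> z n x @[n --> \oo] --> m x.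
  move=> /zcv /cvg_ex[l cl].
  have cle : (z n x)%:E @[n --> \oo] --> l%:E by apply: cvg_EFin; [exact: nearW|exact: cl].
  by rewrite /m (cvg_limn_einf_sup cle).2.
have Gm : mble G m.
  apply/mbleP; first exact: sG.1.
  have : measurable_fun [set: g_sigma_algebraType G] (fun x => limn_esup (fun n => (z n x)%:E)).
    apply: (@measurable_fun_limn_esup _ (g_sigma_algebraType G) R setT (fun n x => (z n x)%:E)) => n.
    by apply/measurable_EFinP; apply/mbleP => //; exact: sG.1.
  by move=> mm; apply: (measurableT_comp _ mm); exact: fine_measurable.
have aezm : {ae P, forall x, z n x @[n --> \oo] --> m x} by apply: filterS Dfin.
have Iz0 : integ P (z 0%N) by have [] := HH.2 _ (Hz 0%N).
have IDf : integ P (fun x => fine (D x)).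
  apply/integrableP; split.
    by apply/measurable_EFinP; apply: (measurableT_comp _ mD); exact: fine_measurable.
  have /integrableP[_] := ID; apply: le_lt_trans.
  apply: ge0_le_integral => //.
  - apply: measurableT_comp => //; apply/measurable_EFinP.
    by apply: (measurableT_comp _ mD); exact: fine_measurable.
  - exact: measurableT_comp.
  - by move=> x _ /=; have := D0 x; case: (D x) => [r||] //= _; rewrite normr0 leey.
have [] := @Ex_dct_ae _ _ _ P z m (fun x => 1 * `|z 0%N x| + 1 * fine (D x)) mz _ _ aezm.
- exact: mble_meas Gm.
- by apply: integ_lin => //; exact: integrable_norm.
- apply: filterS Dfin => x Dx n.
  rewrite !mul1r; have -> : z n x = z 0%N x + \sum_(0 <= k < n) (z k.+1 x - z k x).
    by rewrite telescope_sumr// addrC subrK.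
  rewrite (le_trans (ler_normD _ _))// lerD2l (le_trans (ler_norm_sum _ _ _))//.
  exact: part.
move=> Im Em; exists m; split => //.
have E0 : (fun n => Ex P (z n)) = fun=> 0 by apply/funext => n; have [] := HH.2 _ (Hz n).
rewrite E0 in Em; apply: (cvg_unique _ Em) => //; exact: cvg_cst.
Qed.

End projection.

End fixed_space.
End gaussian_space.

Section gaussian_independence.
Context d (T : measurableType d) (R : realType) (P : probability T R).
Implicit Types (H S : set (T -> R)) (f g W L M : T -> R).

(** The case of [bclos_Ex] where one of the two variables is the constant E[g]. *)
Lemma bclos_uncorrelated (K : set (T -> R)) g : bmeas g ->
  (forall f, K f -> bmeas f /\ Ex P (fun x => f x * g x) = Ex P f * Ex P g) ->
  forall f, bclos K f -> bmeas f /\ Ex P (fun x => f x * g x) = Ex P f * Ex P g.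
Proof.
move=> bg KK f Kf.
have Eg h : bmeas h -> Ex P (fun x => h x * Ex P g) = Ex P h * Ex P g.
  by move=> bh; rewrite ExZr//; exact: bmeas_integ.
have [||h /KK[bh e]|bf e] := @bclos_Ex _ _ _ P K g (fun=> Ex P g) _ _ _ f Kf.
- exact: bmeas_integ.
- exact: bmeas_integ (bmeas_cst T _).
- by split; rewrite ?Eg.
- by split; rewrite -?Eg.
Qed.

(** The factorization passes from the cosines and sines to the indicators by
    [bclos_uncorrelated], first in one variable, then in the other. *)
Lemma trig_indep (L1 L2 : set (T -> R)) (F1 F2 : set (set T)) : linear_space L1 -> linear_space L2 ->
  (forall W, L1 W -> measurable_fun setT W) -> (forall W, L2 W -> measurable_fun setT W) ->
  F1 `<=` measurable -> F2 `<=` measurable ->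
  F1 `<=` trig_sets L1 -> F2 `<=` trig_sets L2 ->
  (forall f g, trig L1 f -> trig L2 g -> Ex P (fun x => f x * g x) = Ex P f * Ex P g) ->
  indep P F1 F2.
Proof.
move=> l1 l2 m1 m2 mF1 mF2 F1t F2t fg A B FA FB.
have bt (L : set (T -> R)) f : (forall W, L W -> measurable_fun setT W) -> trig L f -> bmeas f.
  move=> mL tf; split; last by exists 1; exact: trig_le1 tf.
  case: tf => W LW [] ->; first exact: measurableT_comp (@measurable_cos R) (mL _ LW).
  exact: measurableT_comp (@measurable_sin R) (mL _ LW).
have mA := mF1 _ FA; have mB := mF2 _ FB.
have s1 g : trig L2 g -> Ex P (fun x => \1_A x * g x) = Ex P (\1_A : T -> R) * Ex P g.
  move=> tg; have bg := bt _ _ m2 tg.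
  have [] := @bclos_uncorrelated (trig L1) g bg _ _ (F1t _ FA) => //.
  by move=> f tf; split; [exact: bt tf|exact: fg].
have bA := @bmeas_indic _ T R A mA.
have [_ s2] : bmeas (\1_B : T -> R) /\
    Ex P (fun x => \1_B x * \1_A x) = Ex P (\1_B : T -> R) * Ex P (\1_A : T -> R).
  apply: (@bclos_uncorrelated (trig L2) _ bA _ _ (F2t _ FB)) => g tg.
  split; first exact: bt tg.
  by rewrite mulrC -s1//; apply: Ex_ext => x; rewrite mulrC.
have : Ex P (\1_(A `&` B) : T -> R) = Ex P (\1_A : T -> R) * Ex P (\1_B : T -> R).
  by rewrite mulrC -s2; apply: Ex_ext => x; rewrite indicI mulrC.
rewrite !Ex_indic//; last exact: measurableI.
move=> e; rewrite -[LHS]fineK ?fin_num_measure//; last exact: measurableI.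
by rewrite e EFinM !fineK// fin_num_measure.
Qed.

Section regression.
Variables (H S : set (T -> R)).
Hypothesis HH : gaussian_family P H.
Hypothesis SL : linear_space S.
Hypothesis SH : S `<=` H.

Lemma gaussian_Ex_sum (V : Type) (s : seq V) (c : V -> R) (f : V -> T -> R) M :
  (forall v, H (f v)) -> H M ->
  H (fun x => \sum_(v <- s) c v * f v x) /\
  Ex P (fun x => (\sum_(v <- s) c v * f v x) * M x) =
    \sum_(v <- s) c v * Ex P (fun x => f v x * M x).
Proof.
move=> Hf HM; elim: s => [|v s [IH1 IH2]].
  under eq_fun do rewrite big_nil; split; first exact: HH.1.1.
  by rewrite big_nil; under [X in Ex _ X]eq_fun do rewrite big_nil mul0r; rewrite Ex_cst.
have e x : \sum_(w <- v :: s) c w * f w x = c v * f v x + 1 * \sum_(w <- s) c w * f w x.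
  by rewrite big_cons mul1r.
under eq_fun do rewrite e; split; first exact: HH.1.2.
under [X in Ex _ X]eq_fun do rewrite e.
by rewrite (gaussian_Ex_linl HH)// IH2 mul1r big_cons.
Qed.

Local Notation h n := ((1 / 2 : R) ^+ n).

(** Each [Y v] splits into its projection m v on the closure of [S] and a
    residual. Linear combinations of residuals are limits of elements L_n of the
    Gaussian family that are nearly orthogonal to [S], so in the limit
    [trig_near_uncorrelated] gives exact factorization of the cosines and sines,
    and [trig_indep] the independence of the residuals from [G]. Independence
    and centredness of the residual make m v a conditional expectation. *)
Lemma gaussian_regression (V : finType) (Y : V -> T -> R) (G : set (set T)) : sub_sigma G ->
  (forall W, S W -> mble G W) -> G `<=` trig_sets S -> (forall v, H (Y v)) ->
  exists m : V -> T -> R,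
    (forall v, [/\ mble G (m v), integ P (m v) &
       forall A, G A -> Ex P (fun x => \1_A x * Y v x) = Ex P (fun x => \1_A x * m v x)]) /\
    indep P (sigma_family [set: V] (fun v x => Y v x - m v x)) G.
Proof.
move=> sG SG GS HY.
have [z Hz] : exists z : V -> nat -> T -> R, forall v,
   [/\ forall n, S (z v n),
      forall n, Ex P (fun x => (1 * z v n.+1 x + -1 * z v n x) ^+ 2) <= 4 * (h n * h n) &
      forall n W, S W -> `|Ex P (fun x => (1 * Y v x + -1 * z v n x) * W x)| <=
        h n * (1 + Ex P (fun x => W x ^+ 2))].
  by exists (fun v => sval (cid (minimizing_sequence HH SL SH (HY v)))) => v; exact: (svalP (cid (minimizing_sequence HH SL SH (HY v)))).
have Sz v n : S (z v n) by case: (Hz v).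
have [m Hm] : exists m : V -> T -> R, forall v, [/\ mble G (m v), integ P (m v), Ex P (m v) = 0 &
    {ae P, forall x, z v n x @[n --> \oo] --> m v x}].
  have ex v : exists m, [/\ mble G m, integ P m, Ex P m = 0 &
      {ae P, forall x, z v n x @[n --> \oo] --> m x}].
    apply: (@fast_sequence_limit _ _ _ P H HH G (z v) sG).
    - by move=> n; exact: SH.
    - by move=> n; exact: SG.
    - by case: (Hz v).
  by exists (fun v => sval (cid (ex v))) => v; exact: (svalP (cid (ex v))).
exists m.
pose eps v x := Y v x - m v x.
have mY v : measurable_fun setT (Y v) by have [] := HH.2 _ (HY v).
have IY v : integ P (Y v) by have [] := HH.2 _ (HY v).
have mm v : measurable_fun setT (m v) by case: (Hm v) => /(mble_meas sG).
have meps v : measurable_fun setT (eps v) by exact: measurable_funB.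
pose L1 : set (T -> R) := [set f | exists u : V -> R, f = fun x => \sum_v u v * eps v x].
have l1 : linear_space L1.
  split; first by exists (fun=> 0); apply/funext => x; rewrite big1// => v _; rewrite mul0r.
  move=> a b _ _ [u ->] [w ->]; exists (fun v => a * u v + b * w v); apply/funext => x.
  by rewrite !mulr_sumr -big_split; apply: eq_bigr => v _ /=; ring.
have mL1 W : L1 W -> measurable_fun setT W.
  move=> [u ->]; apply: measurable_sum => v; apply: measurable_funM => //; exact: measurable_cst.
have eL1 v : L1 (eps v).
  exists (fun w => (w == v)%:R); apply/funext => x.
  rewrite (bigD1 v)//= eqxx mul1r big1 ?addr0// => w /negbTE ->; exact: mul0r.
set Se := sigma_family _ _.
have sE : sub_sigma Se.
  apply: sub_sigma_gen_sub => _ [v _ [B mB <-]]; exact: meps.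
have SeT : Se `<=` trig_sets L1.
  apply: smallest_sub; first exact: trig_sets_sigma.
  by move=> _ [v _ [B mB <-]]; rewrite setTI; apply: (linear_space_trig_mble l1 (eL1 v)).
(* phi and psi range over cosine and sine *)
have key L M (phi psi : R -> R) : L1 L -> S M ->
    phi = @cos R \/ phi = @sin R -> psi = @cos R \/ psi = @sin R ->
    Ex P (fun x => phi (L x) * psi (M x)) = Ex P (fun x => phi (L x)) * Ex P (fun x => psi (M x)).
  move=> [u Lu] SM hphi hpsi; have HM := SH SM; have mL := mL1 L (ex_intro _ u Lu).
  have mM : measurable_fun setT M by have [] := HH.2 _ HM.
  have prop (f : R -> R) : f = @cos R \/ f = @sin R ->
      [/\ measurable_fun setT f, continuous f & forall x, `|f x| <= 1].
    case=> ->; split; [exact: measurable_cos|exact: continuous_cos|exact: cos_max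
      |exact: measurable_sin|exact: continuous_sin|exact: sin_max].
  have [mphi cphi phi1] := prop _ hphi; have [mpsi cpsi psi1] := prop _ hpsi.
  pose r v n x := 1 * Y v x + -1 * z v n x.
  have Hr v n : H (r v n) by apply: HH.1.2 => //; exact: SH.
  pose Ln n x := \sum_v u v * r v n x.
  have HLn n : H (Ln n) by have [] := gaussian_Ex_sum (index_enum V) u (fun v => Hr v n) HM.
  have mLn n : measurable_fun setT (Ln n) by have [] := HH.2 _ (HLn n).
  pose i n := Ex P (fun x => Ln n x * M x).
  pose C := (\sum_v `|u v|) * (1 + Ex P (fun x => M x ^+ 2)).
  have iC n : `|i n| <= h n * C.
    have [_ iE] := gaussian_Ex_sum (index_enum V) u (fun v => Hr v n) HM.
    rewrite /i iE (le_trans (ler_norm_sum _ _ _))// /C mulrCA mulr_suml.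
    apply: ler_sum => v _; rewrite normrM ler_wpM2l//.
    by have [_ _] := Hz v; apply.
  have h0 : h n @[n --> \oo] --> (0 : R).
    by apply: cvg_expr; rewrite ger0_norm; lra.
  have i0 : i n @[n --> \oo] --> (0 : R).
    have hC : h n * C @[n --> \oo] --> (0 : R).
      by rewrite -[X in _ --> X](mul0r C); apply: cvgM => //; exact: cvg_cst.
    apply: norm_cvg0; apply: (squeeze_cvgr _ (cvg_cst (0 : R)) hC).
    by apply: nearW => n; rewrite normr_ge0/=.
  have bound0 : `|expR (i n) - 1| + `|expR (- i n) - 1| @[n --> \oo] --> (0 : R).
    have e1 : expR (i n) @[n --> \oo] --> expR (0 : R).
      by apply: continuous_cvg => //; exact: continuous_expR.
    have e2 : expR (- i n) @[n --> \oo] --> expR (0 : R).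
      apply: continuous_cvg; first exact: continuous_expR.
      by rewrite -oppr0; exact: cvgN.
    rewrite expR0 in e1 e2.
    have n0 : `|1 - 1| + `|1 - 1| = 0 :> R by rewrite subrr normr0 addr0.
    rewrite -[X in _ --> X]n0; apply: cvgD; apply: cvg_norm; apply: cvgB => //; exact: cvg_cst.
  have aeL : {ae P, forall x, Ln n x @[n --> \oo] --> L x}.
    have : {ae P, forall x, forall v, z v k x @[k --> \oo] --> m v x}.
      by apply: ae_forall_fin => v; case: (Hm v).
    apply: filterS => x zx; rewrite Lu /Ln.
    elim: (index_enum V) => [|v s IH].
      rewrite big_nil (_ : (fun n => _) = fun=> 0); first exact: cvg_cst.
      by apply/funext => n; rewrite big_nil.
    rewrite big_cons (_ : (fun n => _) =
      fun n => u v * r v n x + \sum_(v0 <- s) u v0 * r v0 n x); last first.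
      by apply/funext => n; rewrite big_cons.
    apply: cvgD => //; apply: cvgM; first exact: cvg_cst.
    rewrite /r /eps (_ : Y v x - m v x = 1 * Y v x + -1 * m v x); last by ring.
    apply: cvgD; first exact: cvg_cst.
    by apply: cvgM; [exact: cvg_cst|exact: zx].
  have I1 := bmeas_integ P (bmeas_cst T (1 : R)).
  have [_ c1] : integ P (fun x => phi (L x) * psi (M x)) /\
      Ex P (fun x => phi (Ln n x) * psi (M x)) @[n --> \oo] --> Ex P (fun x => phi (L x) * psi (M x)).
    apply: (@Ex_dct_ae _ _ _ P (fun n x => phi (Ln n x) * psi (M x)) _ (fun=> 1)) => //.
    - by move=> n; apply: measurable_funM; apply: measurableT_comp.
    - by apply: measurable_funM; apply: measurableT_comp.
    - apply: filterS aeL => x Lx; apply: cvgM; last exact: cvg_cst.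
      by apply: continuous_cvg => //; exact: cphi.
    - by apply: aeW => x n; rewrite normrM mulr_ile1.
  have [_ c2] : integ P (fun x => phi (L x)) /\
      Ex P (fun x => phi (Ln n x)) @[n --> \oo] --> Ex P (fun x => phi (L x)).
    apply: (@Ex_dct_ae _ _ _ P (fun n x => phi (Ln n x)) _ (fun=> 1)) => //.
    - by move=> n; apply: measurableT_comp.
    - by apply: measurableT_comp.
    - by apply: filterS aeL => x Lx; apply: continuous_cvg => //; exact: cphi.
    - by apply: aeW => x n.
  apply/eqP; rewrite -subr_eq0; apply/eqP.
  have c3 : Ex P (fun x => phi (Ln n x) * psi (M x)) -
      Ex P (fun x => phi (Ln n x)) * Ex P (fun x => psi (M x)) @[n --> \oo] -->
      Ex P (fun x => phi (L x) * psi (M x)) -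
      Ex P (fun x => phi (L x)) * Ex P (fun x => psi (M x)).
    by apply: cvgB => //; apply: cvgM => //; exact: cvg_cst.
  apply: (cvg_unique _ c3) => //.
  apply: norm_cvg0; apply: (squeeze_cvgr _ (cvg_cst (0 : R)) bound0).
  apply: nearW => n; rewrite normr_ge0/=.
  exact: (trig_near_uncorrelated HH (HLn n) HM hphi hpsi).
have ind : indep P Se G.
  apply: (@trig_indep L1 S) => //.
  - by move=> W /SH HW; have [] := HH.2 _ HW.
  - exact: sE.2.
  - exact: sG.2.
  move=> f g [L LL fE] [M SM gE].
  case: fE gE => -> [] ->; apply: key => //; by [left|right].
split => // v; have [Gm Im Em0 _] := Hm v; split => // A GA.
have mA : measurable A by exact: sG.2.
have bA := @bmeas_indic _ T R A mA.
have Ieps : integ P (eps v).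
  by have := integ_lin 1 (-1) (IY v) Im; apply: integ_ext => x; rewrite mul1r mulN1r.
have Eeps : Ex P (eps v) = 0.
  transitivity (1 * Ex P (Y v) + -1 * Ex P (m v)).
    by rewrite -Ex_lin//; apply: Ex_ext => x; rewrite mul1r mulN1r.
  by have [_ _ _ -> _] := HH.2 _ (HY v); rewrite Em0 !mulr0 addr0.
have : Ex P (fun x => eps v x * \1_A x) = Ex P (fun x => eps v x * fine (P A)).
  apply: (@pull_out_integrable _ _ _ P Se) => //; first exact: bmeas_cst.
    move=> B mB; apply: sub_sigma_algebra; exists v => //.
    by exists B => //; rewrite setTI.
  move=> E SE; have mE : measurable E by exact: sE.2.
  transitivity (Ex P (\1_(E `&` A) : T -> R)).
    by apply: Ex_ext => x; rewrite indicI.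
  rewrite ExZr; last exact/bmeas_integ/bmeas_indic.
  rewrite !Ex_indic//; last exact: measurableI.
  by rewrite ind// fineM ?fin_num_measure.
rewrite ExZr// Eeps mul0r.
move=> e; apply/eqP; rewrite -subr_eq0 -e -[X in X - _]mul1r -mulN1r; apply/eqP.
rewrite -Ex_lin; [|exact: integM|exact: integM].
by apply: Ex_ext => x; rewrite /eps; ring.
Qed.

End regression.
End gaussian_independence.

(** * Gaussian processes depend on their past in the mean only *)

Section gaussian_case.
Context d (T : measurableType d) (R : realType) (P : probability T R) (V : finType)
  (X : V -> int -> {RV P >-> R}).
Hypothesis HG : gaussian_process X.

(** Constants are included so that the variables can be centred; a combination
    is a list of coefficients and (vertex, time) pairs satisfying [Q]. *)
Definition affine_span (Q : pred (V * int)) : set (T -> R) :=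
  [set W | exists s k, all (fun p : R * (V * int) => Q p.2) s /\
    W = fun w => \sum_(p <- s) p.1 * X p.2.1 p.2.2 w + k].

Definition centered_span Q : set (T -> R) := [set W | affine_span Q W /\ Ex P W = 0].

Lemma affine_span_meas Q W : affine_span Q W -> measurable_fun setT W.
Proof.
move=> [s [k [_ ->]]]; apply: measurable_funD; last exact: measurable_cst.
apply: measurable_sum => p; apply: measurable_funM; first exact: measurable_cst.
exact: X_meas.
Qed.

(** Centring at m, without knowing yet that m is the mean, reduces to the moment
    generating function of a centred normal law. *)
Lemma affine_span_mgf Q W : affine_span Q W -> exists m q : R, 0 <= q /\
  forall u : R, integ P (fun x => expR (u * (W x - m))) /\
    Ex P (fun x => expR (u * (W x - m))) = expR (u ^+ 2 * q / 2).
Proof.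
move=> [s [k [_ ->]]].
pose c j := (tnth (in_tuple s) j).1.
pose v j := (tnth (in_tuple s) j).2.1.
pose r j := (tnth (in_tuple s) j).2.2.
pose L w := \sum_(j < size s) c j * X (v j) (r j) w.
have mL : measurable_fun setT L.
  apply: measurable_sum => j; apply: measurable_funM; first exact: measurable_cst.
  exact: X_meas.
have [m [q [q0 Lmgf]]] := gaussian_law_mgf mL (HG c v r).
exists (m + k), q; split => // u; have [IL EL] := Lmgf u.
have e x : expR (u * L x) * expR (- (u * m)) =
    expR (u * (\sum_(p <- s) p.1 * X p.2.1 p.2.2 x + k - (m + k))).
  by rewrite (big_tnth _ _ s) -expRD; congr expR; rewrite /L; ring.
split.
  apply: integ_ext (integM (bmeas_cst _ (expR (- (u * m)))) IL) => x.
  by rewrite mulrC e.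
by rewrite -(Ex_ext P e) ExZr// EL -expRD; congr expR; ring.
Qed.

Lemma affine_span_meas_shift Q W (m : R) : affine_span Q W ->
  measurable_fun setT (fun x => W x - m).
Proof.
by move=> /affine_span_meas mW; apply: measurable_funB => //; exact: measurable_cst.
Qed.

Lemma affine_span_integ Q W : affine_span Q W -> integ P W.
Proof.
move=> QW; have [m [q [q0 mgf]]] := affine_span_mgf QW.
have I1 := gaussian_integ (affine_span_meas_shift m QW) (fun u => (mgf u).1).
have := integ_lin 1 m I1 (bmeas_integ P (bmeas_cst T 1)).
by apply: integ_ext => x; rewrite mul1r mulr1 subrK.
Qed.

Lemma centered_span_gaussian Q W : centered_span Q W -> gaussian_like P W.
Proof.
move=> [QW EW0]; have [m [q [q0 mgf]]] := affine_span_mgf QW.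
have mW := affine_span_meas QW; have IW := affine_span_integ QW.
have m0 : m = 0.
  have := gaussian_Ex (affine_span_meas_shift m QW) q0 (fun u => (mgf u).1) (fun u => (mgf u).2).
  have -> : Ex P (fun x => W x - m) = 1 * Ex P W + (- m) * Ex P (fun=> 1 : R).
    rewrite -Ex_lin//; last exact: bmeas_integ (bmeas_cst T _).
    by apply: Ex_ext => x; ring.
  by rewrite EW0 Ex_cst mulr0 add0r mulr1 => /eqP; rewrite oppr_eq0 => /eqP.
have {m m0}mgf u : integ P (fun x => expR (u * W x)) /\
    Ex P (fun x => expR (u * W x)) = expR (u ^+ 2 * q / 2).
  have e x : expR (u * (W x - m)) = expR (u * W x) by rewrite m0 subr0.
  by have [I E] := mgf u; rewrite -(Ex_ext P e); split => //; exact: integ_ext I.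
have iW u := (mgf u).1; have EW u := (mgf u).2.
have E2 := gaussian_Ex2 mW q0 iW EW.
split => //; first exact: gaussian_integ2 mW iW.
by rewrite E2; split; [exact: gaussian_cos mW q0 iW EW|exact: gaussian_sin mW q0 iW EW].
Qed.

Lemma centered_span_linear Q : linear_space (centered_span Q).
Proof.
split.
  split; last by rewrite Ex_cst.
  by exists [::], 0; split => //; apply/funext => x; rewrite big_nil addr0.
move=> a b f g [Qf f0] [Qg g0]; split; last first.
  by rewrite Ex_lin ?f0 ?g0 ?mulr0 ?addr0//; [exact: affine_span_integ Qf|exact: affine_span_integ Qg].
move: Qf Qg => [s [k [Qs ->]]] [s' [k' [Qs' ->]]].
exists ([seq (a * p.1, p.2) | p <- s] ++ [seq (b * p.1, p.2) | p <- s']), (a * k + b * k').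
split; first by rewrite all_cat !all_map; apply/andP; split.
apply/funext => x; rewrite big_cat !big_map/= !mulrDr !mulr_sumr.
by rewrite addrACA; congr (_ + _ + _); apply: eq_bigr => p _; rewrite mulrA.
Qed.

Lemma centered_span_X (Q : pred (V * int)) v s : Q (v, s) ->
  centered_span Q (fun x => X v s x - Ex P (X v s)).
Proof.
move=> Qvs; have aff k : affine_span Q (fun x => X v s x + k).
  exists [:: (1, (v, s))], k; split; first by rewrite /= Qvs.
  by apply/funext => x; rewrite big_seq1 mul1r.
split; first exact: aff.
have IX : integ P (X v s) by apply: integ_ext (affine_span_integ (aff 0)) => x; rewrite addr0.
transitivity (1 * Ex P (X v s) + (- Ex P (X v s)) * Ex P (fun=> 1 : R)).
  rewrite -Ex_lin//; last exact: bmeas_integ (bmeas_cst T _).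
  by apply: Ex_ext => x; ring.
by rewrite Ex_cst; ring.
Qed.

(** Regression of the centred X_v(t+1) on the centred span of the past, whose
    sigma-algebra is F_V(t) because centring is a shift by a constant. *)
Lemma gaussian_past_only : past_only_in_mean X.
Proof.
move=> t; set G := past X [set: V]%SET t.
have sG : sub_sigma G by exact: past_sub_sigma.
pose Q (vs : V * int) := vs.2 <= t.
have gH : gaussian_family P (centered_span predT).
  by split; [exact: centered_span_linear|exact: centered_span_gaussian].
have SH : centered_span Q `<=` centered_span predT.
  move=> W [[s [k [_ ->]]] E0]; split => //; exists s, k; split => //.
  exact: all_predT.
have SG W : centered_span Q W -> mble G W.
  move=> [[s [k [Qs ->]]] _]; apply: (mbleD sG); last exact: (mble_cst sG).
  elim: s Qs => [|p s IH] /=; first by under eq_fun do rewrite big_nil; move=> _; exact: (mble_cst sG).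
  move=> /andP[Qp Qs]; under eq_fun do rewrite big_cons.
  apply: (mbleD sG); last exact: IH.
  apply: (mbleM sG); first exact: (mble_cst sG).
  by move=> B mB; apply: past_gen => //; rewrite finset.in_setT.
pose c v s : R := Ex P (X v s).
have GS : G `<=` trig_sets (centered_span Q).
  apply: smallest_sub; first exact: trig_sets_sigma (centered_span_linear Q).
  move=> _ [[v s] /= [_ st] [B mB <-]]; rewrite setTI.
  have mW := linear_space_trig_mble (centered_span_linear Q) (@centered_span_X Q v s st).
  have mB' : measurable [set y | B (y + c v s)].
    rewrite -[X in measurable X]setTI.
    apply: (measurable_funD (@measurable_id _ _ setT) (measurable_cst (c v s))) => //.
  have := mW _ mB'; congr (trig_sets _ _).
  by apply/seteqP; split => x /=; rewrite /c subrK.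
have [m [Hm ind]] := gaussian_regression gH (centered_span_linear Q) SH sG SG GS
  (fun v => @centered_span_X predT v (t + 1) isT).
exists (fun v w => m v w + c v (t + 1)); split.
  move=> v; apply/is_cond_expP => //; have [Gm Im Em] := Hm v.
  have IX : integ P (X v (t + 1)).
    apply: (@affine_span_integ predT); exists [:: (1, (v, t + 1))], 0; split => //.
    by apply/funext => x; rewrite big_seq1 mul1r addr0.
  have I1 := bmeas_integ P (bmeas_cst T (1 : R)).
  split => //.
  - by apply: integ_ext (integ_lin 1 (c v (t + 1)) Im I1) => x; rewrite mul1r mulr1.
  - by apply: (mbleD sG) => //; exact: mble_cst.
  move=> A GA; have mA : measurable A by exact: sG.2.
  have bA := @bmeas_indic _ T R A mA.
  have IY : integ P (fun x => X v (t + 1) x - Ex P (X v (t + 1))).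
    by apply: integ_ext (integ_lin 1 (- c v (t + 1)) IX I1) => x; rewrite mul1r mulr1.
  have := Em A GA => {}Em.
  transitivity (1 * Ex P (fun x => \1_A x * (X v (t + 1) x - Ex P (X v (t + 1)))) +
      c v (t + 1) * Ex P (\1_A : T -> R)).
    rewrite -Ex_lin; [|exact: integM|exact: bmeas_integ].
    by apply: Ex_ext => x; rewrite /c; ring.
  rewrite Em -Ex_lin; [|exact: integM|exact: bmeas_integ].
  by apply: Ex_ext => x; ring.
move: ind; rewrite /c; congr (indep _ (sigma_family _ _) _).
by apply/funext => v; apply/funext => w; rewrite opprD addrA addrAC.
Qed.

End gaussian_case.

Theorem proposition3p1 (d : measure_display) (T : measurableType d)
    (R : realType) (P : probability T R) (V : finType)
    (X : V -> int -> {RV P >-> R}) (G : mixed_graph V)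
    (hstat : stationary X)
    (hsep : forall (A B C : {set V}) (k : nat) (t : int), (0 < k)%N ->
       measurably_separable P (past X A t) (past X B t)
         (join_sigma (past X (A :&: B)%SET t) (past X C (t - k%:Z))))
    (hcond : [\/ gaussian_process X,
                 contemporaneously_independent X |
                 past_only_in_mean X]) :
  (block_markov G X <-> local_markov G X) /\
  (local_markov G X <-> pairwise_markov G X).
Proof.
have comp : composable X.
  case: hcond => [/gaussian_past_only|/contemp_indep_composable|] //; exact: past_only_composable.
split; split.
- exact: block_local.
- exact: local_block.
- exact: local_pairwise.
- exact: pairwise_local.
Qed.
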